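(* Suppose there exists an algorithm $\mathcal{T}$ that is a hyper-efficient shadow tomography procedure for all mixed quantum states, with number of copies $k=k(n,\log M,1/\varepsilon,\log(1/\delta))$ for polynomial $k$. Then there does not exist a $k$-copy secure untelegraphable encryption scheme that also satisfies correctness.
   Context: $\lambda$ is the security parameter; QPT means quantum polynomial time; $\mathrm{negl}$ denotes a negligible function. Hyper-efficient shadow tomography (HEST). Let $E$ denote a uniform quantum circuit family with classical binary output that takes as input $i\in[M]$ and an $n$-qubit quantum state $\rho$. A shadow tomography procedure $\mathcal{T}$ takes as input $E$ and $k$ copies of $\rho$, and outputs (a classical description of) a quantum circuit $C$ such that, for $i\in[M]$, $\Pr[|C(i)-\Pr[E(i,\rho)=1]|\le\varepsilon]\ge1-\delta$. The procedure is hyper-efficient if the number of copies $k$ and the runtime are both $\mathrm{poly}(n,\log M,1/\varepsilon,\log 1/\delta)$. Untelegraphable encryption (UTE). A tuple of QPT algorithms $(\mathsf{Gen},\mathsf{Enc},\mathsf{Dec})$: $\mathsf{Gen}(1^\lambda)$ outputs classical encryption and decryption keys $(\mathsf{ek},\mathsf{dk})$ (possibly equal, $\mathsf{ek}=\mathsf{dk}=\mathsf{sk}$); $\mathsf{Enc}(\mathsf{ek},m)$ outputs a quantum ciphertext; $\mathsf{Dec}(\mathsf{dk},\cdot)$ takes a quantum ciphertext and outputs a message. Correctness: for every $\lambda$ and every message $m$, $\Pr[\mathsf{Dec}(\mathsf{dk},\mathsf{Enc}(\mathsf{ek},m))=m]\ge1-\mathrm{negl}(\lambda)$, where $(\mathsf{ek},\mathsf{dk})\leftarrow\mathsf{Gen}(1^\lambda)$.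 $t$-copy security. For a bit $b$ and a two-stage adversary $(\mathcal{A},\mathcal{B})$: $\mathcal{A}$ specifies a single pair of messages $(m_0,m_1)$ and gets $t$ encryptions of $m_b$ (under the same key) in return; $\mathcal{A}$ outputs a classical string $\mathsf{st}$; $\mathcal{B}$ receives $\mathsf{st}$ and the decryption key $\mathsf{dk}$ and outputs a bit $b_{\mathcal{B}}$. The scheme is $t$-copy secure if for all QPT $(\mathcal{A},\mathcal{B})$, $|\Pr[b_{\mathcal{B}}=1\mid b=0]-\Pr[b_{\mathcal{B}}=1\mid b=1]|=\mathrm{negl}(\lambda)$. *)

(* Defs.v *)
From HB Require Import structures.
From mathcomp Require Import all_boot all_order all_algebra.
From mathcomp Require Import mpoly.
From mathcomp Require Import reals complex.

Set Implicit Arguments.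
Unset Strict Implicit.
Unset Printing Implicit Defensive.

Import Order.TTheory GRing.Theory Num.Theory.
Local Open Scope ring_scope.

(** * Classical polynomial time

    Structured programs over finitely many stacks of bits; one elementary stack
    operation or test costs one time unit.  Two stacks simulate a Turing-machine
    tape and a stack is half a tape, so up to polynomial overhead this is the
    multi-tape Turing machine. *)

Notation bits := (seq bool).

Inductive prog : Type :=
  | Skip
  | Push of nat & bool
  | Pop of nat
  | Seq of prog & prog
  (* Case r pe p0 p1 : stack r is empty / has top bit 0 / has top bit 1 *)
  | Case of nat & prog & prog & prog
  (* While r p : run p as long as stack r is nonempty *)
  | While of nat & prog.

Definition store := nat -> bits.

Definition upd (s : store) (r : nat) (w : bits) : store :=
  fun r' => if r' == r then w else s r'.

Inductive exec : prog -> store -> nat -> store -> Prop :=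
  | ExecSkip s : exec Skip s 1 s
  | ExecPush r b s : exec (Push r b) s 1 (upd s r (b :: s r))
  | ExecPop r s : exec (Pop r) s 1 (upd s r (behead (s r)))
  | ExecSeq p q s t s1 t' s2 :
      exec p s t s1 -> exec q s1 t' s2 -> exec (Seq p q) s (t + t')%N s2
  | ExecCase r pe p0 p1 s t s1 :
      exec (if s r is b :: _ then (if b then p1 else p0) else pe) s t s1 ->
      exec (Case r pe p0 p1) s t.+1 s1
  | ExecWhileEnd r p s : s r = [::] -> exec (While r p) s 1 s
  | ExecWhileStep r p s t s1 t' s2 :
      s r <> [::] -> exec p s t s1 -> exec (While r p) s1 t' s2 ->
      exec (While r p) s (t + t').+1 s2.

(* Inputs are on stacks 0, 1, ...; all other stacks are empty.  The output is
   read from stack 0. *)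
Definition computes_within (p : prog) (ins : seq bits) (T : nat) (out : bits) :=
  exists t s, [/\ exec p (nth [::] ins) t s, (t <= T)%N & s 0%N = out].

Definition unary (n : nat) : bits := nseq n true.

Definition ptime (f : nat -> bits) : Prop :=
  exists (p : prog) (P : {poly nat}), forall lam,
    computes_within p [:: unary lam] P.[lam] (f lam).

(* The m low-order binary digits of i, least significant first. *)
Definition binary (m i : nat) : bits := [seq odd (i %/ 2 ^ j) | j <- iota 0 m].

(** * Serialization

    A sequence of naturals is written as 1^a 0 1^b 0 ... *)

Definition code_nats (s : seq nat) : bits :=
  flatten [seq rcons (unary n) false | n <- s].

Fixpoint decode_nats_from (acc : nat) (w : bits) : seq nat :=
  match w with
  | [::] => [::]
  | true :: w' => decode_nats_from acc.+1 w'
  | false :: w' => acc :: decode_nats_from 0 w'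
  end.

Definition decode_nats : bits -> seq nat := decode_nats_from 0.

Fixpoint nats_of_prog (p : prog) : seq nat :=
  match p with
  | Skip => [:: 0%N]
  | Push r b => [:: 1%N; r; nat_of_bool b]
  | Pop r => [:: 2; r]
  | Seq p q => 3 :: nats_of_prog p ++ nats_of_prog q
  | Case r pe p0 p1 =>
      4 :: r :: nats_of_prog pe ++ nats_of_prog p0 ++ nats_of_prog p1
  | While r p => 5 :: r :: nats_of_prog p
  end.

Definition code_prog (p : prog) : bits := code_nats (nats_of_prog p).

(** * Quantum circuits

    Gates act on wires 0, 1, 2, ...  When a circuit is run on an n-qubit input,
    the input is on the first n wires and every further wire starts in |0>; at
    the end the first [outs] wires are the output and the rest is traced out.
    CX c t is controlled-NOT with control c and target t. *)

Inductive gate : Type :=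
  | GX of nat | GH of nat | GT of nat | CX of nat & nat.

Record circuit : Type := Circuit { outs : nat; gates : seq gate }.

Definition nats_of_gate (g : gate) : seq nat :=
  match g with
  | GX j => [:: 1%N; j; 0%N]
  | GH j => [:: 2; j; 0%N]
  | GT j => [:: 3; j; 0%N]
  | CX j k => [:: 4; j; k]
  end.

Fixpoint gates_of_nats (s : seq nat) : seq gate :=
  match s with
  | a :: j :: k :: s' =>
      let gs := gates_of_nats s' in
      match a with
      | 1 => GX j :: gs
      | 2 => GH j :: gs
      | 3 => GT j :: gs
      | 4 => CX j k :: gs
      | _ => gs
      end
  | _ => [::]
  end.

Definition encode (c : circuit) : bits :=
  code_nats (outs c :: flatten [seq nats_of_gate g | g <- gates c]).

(* Total: every bit string describes a circuit, and trailing zeros are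
   irrelevant, so that descriptions can be padded to a fixed length. *)
Definition decode (w : bits) : circuit :=
  if decode_nats w is o :: s then Circuit o (gates_of_nats s)
  else Circuit 0 [::].

Lemma decode_nats_cat (acc n : nat) (w : bits) :
  decode_nats_from acc (rcons (unary n) false ++ w) = (acc + n)%N :: decode_nats w.
Proof.
elim: n acc => [|n IH] acc /=; first by rewrite addn0.
by rewrite IH addSnnS.
Qed.

Lemma code_natsK (s : seq nat) (p : nat) :
  decode_nats (code_nats s ++ nseq p false) = s ++ nseq p 0%N.
Proof.
rewrite /decode_nats; elim: s => [|n s IH] /=; first by elim: p => //= p ->.
by rewrite -catA decode_nats_cat add0n [decode_nats _]IH.
Qed.

Lemma encodeK (c : circuit) (p : nat) : decode (encode c ++ nseq p false) = c.
Proof.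
rewrite /decode /encode code_natsK; case: c => o gs /=; congr Circuit.
elim: gs => [|g gs IH] /=; last by case: g => [j|j|j|j k] /=; rewrite IH.
elim/ltn_ind: p => -[|[|[|p]]] //= IH; exact/IH/leqW/leqW.
Qed.

Definition reach (g : gate) : nat :=
  match g with
  | GX j | GH j | GT j => j.+1
  | CX j k => maxn j.+1 k.+1
  end.

(* Number of wires in use when c is run on n qubits. *)
Definition width (n : nat) (c : circuit) : nat :=
  maxn (maxn n (outs c)) (\max_(g <- gates c) reach g).

Section Semantics.
Variable R : realType.
Local Notation C := R[i].

(* Entries <x| rho |y> of an operator in the computational basis.  An n-qubit
   operator is only ever evaluated at labels x, y of length n. *)
Definition op := bits -> bits -> C.

Definition density (n : nat) (rho : op) : Prop :=
  (forall v : bits -> C,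
     0 <= \sum_(x : n.-tuple bool) \sum_(y : n.-tuple bool)
            (v x)^* * rho x y * v y)
  /\ \sum_(x : n.-tuple bool) rho x x = 1.

Definition basis (s : bits) : op := fun x y => ((x == s) && (y == s))%:R.

(* rho acts on n qubits. *)
Definition tens (n : nat) (rho sigma : op) : op := fun x y =>
  rho (take n x) (take n y) * sigma (drop n x) (drop n y).

Fixpoint tens_pow (n k : nat) (rho : op) : op :=
  if k is k'.+1 then tens n rho (tens_pow n k' rho) else basis [::].

Definition set_bit (x : bits) (j : nat) (b : bool) : bits := set_nth false x j b.

Definition conj1 (u : bool -> bool -> C) (j : nat) (rho : op) : op := fun x y =>
  \sum_(a : bool) \sum_(b : bool)
    u (nth false x j) a * rho (set_bit x j a) (set_bit y j b)
      * (u (nth false y j) b)^*.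

Definition mxX (a b : bool) : C := (a != b)%:R.
Definition mxH (a b : bool) : C := (-1) ^+ (a && b) / sqrtC 2%:R.
(* diag(1, e^(i pi/4)) *)
Definition mxT (a b : bool) : C :=
  (a == b)%:R * (if a then (1 + 'i) / sqrtC 2%:R else 1).

Definition cnot (c t : nat) (x : bits) : bits :=
  if c == t then x else set_bit x t (nth false x t (+) nth false x c).

Definition apply_gate (rho : op) (g : gate) : op :=
  match g with
  | GX j => conj1 mxX j rho
  | GH j => conj1 mxH j rho
  | GT j => conj1 mxT j rho
  | CX c t => fun x y => rho (cnot c t x) (cnot c t y)
  end.

Definition channel (n : nat) (c : circuit) (rho : op) : op :=
  let N := width n c in
  let out := foldl apply_gate (tens n rho (basis (nseq (N - n) false))) (gates c) in
  fun x y => \sum_(z : (N - outs c).-tuple bool) out (x ++ z) (y ++ z).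

(* Probability that measuring all output wires gives y. *)
Definition Pr (n : nat) (c : circuit) (rho : op) (y : bits) : R :=
  complex.Re (channel n c rho y y).

End Semantics.

(** * Quantum polynomial time

    A QPT algorithm is a polynomial-time generated family of circuits Q_(lam, xs)
    indexed by the security parameter (in unary) and the classical inputs xs; its
    quantum input is fed to the circuit. *)

Definition generates (p : prog) (a : nat)
    (Q : nat -> seq bits -> circuit) : Prop :=
  exists P : {poly nat}, forall lam xs, size xs = a ->
    exists2 w, computes_within p (unary lam :: xs)
                 P.[(lam + sumn (map size xs))%N] w
             & Q lam xs = decode w.

Definition qpt (a : nat) (Q : nat -> seq bits -> circuit) : Prop :=
  exists p, generates p a Q.

(** * Hyper-efficient shadow tomography *)

Definition log2up (M : nat) : nat := up_log 2 M.

(* E(i, rho) for i in [M lam] = {0, ..., M lam - 1} and rho on [nq lam] qubits: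
   the circuit selected by the classical input i is run on rho. *)
Record meas_family : Type := MeasFamily {
  nq : nat -> nat;
  M : nat -> nat;
  M_gt0 : forall lam, (0 < M lam)%N;
  E_prog : prog;
  E_circ : nat -> seq bits -> circuit;
  nq_ptime : ptime (fun lam => unary (nq lam));
  M_ptime : ptime (fun lam => binary (log2up (M lam)) (M lam).-1);
  E_uniform : generates E_prog 1 E_circ;
  E_binary : forall lam i, (i < M lam)%N ->
    outs (E_circ lam [:: binary (log2up (M lam)) i]) = 1%N
}.

Section Tomography.
Variable R : realType.

Definition Pr_E (E : meas_family) (lam i : nat) (rho : op R) : R :=
  Pr (nq E lam) (E_circ E lam [:: binary (log2up (M E lam)) i]) rho [:: true].

Definition ceil_nat (x : R) : nat := `|Num.ceil (Num.max 0%R x)%R|%N.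

(* ceil(1/x) *)
Definition inv_up (x : R) : nat := ceil_nat x^-1.

(* ceil(log2(1/x)); log2up (ceil y) = ceil (log2 y) for y >= 1 *)
Definition log_inv_up (x : R) : nat := log2up (inv_up x).

(* k(n, log M, 1/eps, log(1/delta)), with log M, 1/eps, log(1/delta) and the
   value rounded up to naturals *)
Definition copies (k : {mpoly R[4]}) (n logM : nat) (eps delta : R) : nat :=
  let v := [tuple n%:R; logM%:R; (inv_up eps)%:R; (log_inv_up delta)%:R] : _.-tuple R in
  ceil_nat (k.@[tnth v]).

(* The estimate in [0, 1) denoted by an output string: 0.y0y1y2... in binary. *)
Definition value (y : bits) : R :=
  \sum_(j < size y) (nth false y j)%:R / 2%:R ^+ j.+1.

(* Probability that the circuit C, run on the m-bit input i, outputs an estimate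
   of p within eps. *)
Definition Pr_accurate (C : circuit) (m i : nat) (p eps : R) : R :=
  \sum_(y : (outs C).-tuple bool | `|value y - p| <= eps)
     Pr m C (basis R (binary m i)) y.

(* The classical input of the tomography procedure: the code of E, its family
   parameter, the number of qubits, the last index of [M], and the accuracy
   parameters. *)
Definition tomography_input (E : meas_family) (lam : nat) (eps delta : R)
    : seq bits :=
  [:: code_prog (E_prog E); unary lam; unary (nq E lam);
      binary (log2up (M E lam)) (M E lam).-1;
      unary (inv_up eps); unary (log_inv_up delta)].

(* T generates, from its classical input, the circuit [Q] that is run on k copies
   of rho and whose output string w describes the circuit C = decode w.  The
   polynomial bounding the running time may depend on the uniform family E (a
   fixed program), whose own running time is polynomial but otherwise arbitrary. *)
Definition hyper_efficient_shadow_tomography (k : {mpoly R[4]}) (T : prog)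
    : Prop :=
  forall E : meas_family, exists P : {poly nat},
  forall (lam : nat) (eps delta : R), 0 < eps < 1 -> 0 < delta < 1 ->
  let n := nq E lam in
  let m := log2up (M E lam) in
  let kk := copies k n m eps delta in
  exists2 Q : bits,
    computes_within T (tomography_input E lam eps delta)
      P.[(lam + n + m + inv_up eps + log_inv_up delta)%N] Q
  & forall (rho : op R) (i : nat), density n rho -> (i < M E lam)%N ->
    1 - delta <=
      \sum_(w : (outs (decode Q)).-tuple bool)
         Pr (kk * n) (decode Q) (tens_pow n kk rho) w
         * Pr_accurate (decode w) m i (Pr_E E lam i rho) eps.

End Tomography.

(** * Untelegraphable encryption *)

Definition negligible (R : realType) (f : nat -> R) : Prop :=
  forall c : nat, exists lam0 : nat, forall lam : nat,
    (lam0 <= lam)%N -> (0 < lam)%N -> `|f lam| <= (lam%:R ^+ c)^-1.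

(* Keys and messages are bit strings, and ciphertexts qubit registers, of
   efficiently computable lengths. *)
Record ute : Type := UTE {
  eklen : nat -> nat;
  dklen : nat -> nat;
  mlen : nat -> nat;
  clen : nat -> nat;
  Gen : nat -> circuit;
  Enc : nat -> bits -> bits -> circuit;
  Dec : nat -> bits -> circuit;
  eklen_ptime : ptime (fun lam => unary (eklen lam));
  dklen_ptime : ptime (fun lam => unary (dklen lam));
  mlen_ptime : ptime (fun lam => unary (mlen lam));
  clen_ptime : ptime (fun lam => unary (clen lam));
  mlen_gt0 : forall lam, (0 < mlen lam)%N;
  Gen_qpt : qpt 0 (fun lam _ => Gen lam);
  Enc_qpt : qpt 2 (fun lam xs => Enc lam (nth [::] xs 0) (nth [::] xs 1));
  Dec_qpt : qpt 1 (fun lam xs => Dec lam (nth [::] xs 0));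
  Gen_outs : forall lam, outs (Gen lam) = (eklen lam + dklen lam)%N;
  Enc_outs : forall lam ek m, size ek = eklen lam -> size m = mlen lam ->
    outs (Enc lam ek m) = clen lam;
  Dec_outs : forall lam dk, size dk = dklen lam -> outs (Dec lam dk) = mlen lam
}.

Section Security.
Variables (R : realType) (S : ute).

Definition Pr_key (lam : nat) (ek dk : bits) : R :=
  Pr 0 (Gen S lam) (basis R [::]) (ek ++ dk).

Definition ciphertext (lam : nat) (ek m : bits) : op R :=
  channel 0 (Enc S lam ek m) (basis R [::]).

Definition Pr_correct (lam : nat) (m : bits) : R :=
  \sum_(ek : (eklen S lam).-tuple bool) \sum_(dk : (dklen S lam).-tuple bool)
    Pr_key lam ek dk
    * Pr (clen S lam) (Dec S lam dk) (ciphertext lam ek m) m.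

Definition correct : Prop :=
  exists2 nu : nat -> R, negligible nu &
    forall (lam : nat) (m : (mlen S lam).-tuple bool),
      1 - nu lam <= Pr_correct lam m.

(* A1 outputs the two messages (measured) and a quantum state on [rlen] qubits
   kept until A2 receives the ciphertexts. *)
Record adversary : Type := Adversary {
  rlen : nat -> nat;
  A1 : nat -> circuit;
  A2 : nat -> circuit;
  B : nat -> bits -> bits -> circuit;
  A1_qpt : qpt 0 (fun lam _ => A1 lam);
  A2_qpt : qpt 0 (fun lam _ => A2 lam);
  B_qpt : qpt 2 (fun lam xs => B lam (nth [::] xs 0) (nth [::] xs 1));
  A1_outs : forall lam, outs (A1 lam) = (mlen S lam + mlen S lam + rlen lam)%N;
  B_outs : forall lam st dk, outs (B lam st dk) = 1%N
}.

(* State of A1's register when the messages measured are m0 and m1, with trace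
   equal to the probability of this event. *)
Definition kept_state (A : adversary) (lam : nat) (m0 m1 : bits) : op R :=
  fun u v => channel 0 (A1 A lam) (basis R [::]) (m0 ++ m1 ++ u) (m0 ++ m1 ++ v).

(* Pr[b_B = 1 | b] when A gets t encryptions of m_b. *)
Definition Pr_game (t : nat -> nat) (A : adversary) (b : bool) (lam : nat) : R :=
  \sum_(m0 : (mlen S lam).-tuple bool) \sum_(m1 : (mlen S lam).-tuple bool)
  \sum_(ek : (eklen S lam).-tuple bool) \sum_(dk : (dklen S lam).-tuple bool)
    Pr_key lam ek dk *
    \sum_(st : (outs (A2 A lam)).-tuple bool)
      Pr (rlen A lam + t lam * clen S lam) (A2 A lam)
        (tens (rlen A lam) (kept_state A lam m0 m1)
           (tens_pow (clen S lam) (t lam)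
              (ciphertext lam ek (if b then m1 else m0)))) st
      * Pr 0 (B A lam st dk) (basis R [::]) [:: true].

Definition copy_secure (t : nat -> nat) : Prop :=
  forall A : adversary,
    negligible (fun lam => `|Pr_game t A false lam - Pr_game t A true lam|).

End Security.

(* Main.v *)
(* The adversary asks for encryptions of 0...0 or 10...0.  For a fixed ciphertext
   state, E(dk, .) is "decrypt with dk and output the first bit", a uniform family
   of measurements indexed by the decryption keys.  A runs the tomography procedure
   on its k ciphertexts and sends the resulting circuit C to B as the classical
   string; B, who knows dk, evaluates C(dk), which by correctness is close to 1 or
   to 0 for most keys, and outputs the first binary digit of the estimate.  Keys
   of poor correctness are handled by Markov's inequality, so that the advantage
   is at least 1 - 2 delta - o(1). *)

From mathcomp Require Import all_boot all_order all_algebra.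
From mathcomp Require Import mpoly.
From mathcomp Require Import reals complex boolp.
From mathcomp Require Import zify ring lra.
Require Import Defs.

Set Implicit Arguments.
Unset Strict Implicit.
Unset Printing Implicit Defensive.

Import Order.TTheory GRing.Theory Num.Theory.
Local Open Scope ring_scope.


(** Security quantifies over polynomial-time generated adversaries, so the attack has to be
    exhibited as stack programs that print circuit descriptions; this shapes most of the
    development. The tomography circuit is printed by [T] itself once its six inputs have been
    prepared. Two circuits remain to be built from given descriptions: the measurement, a decryption
    circuit cut down to its first output bit, and the last stage, the received circuit run on a
    hard-wired key and cut down likewise. A single operation, [attach], does both, with an empty or
    a full string to hard-wire. The ciphertext state and the decryption key are correlated, but the
    tomography guarantee holds for every state and every index separately, so it is applied to each
    pair of keys and averaged afterwards. The threshold 1/2 explains the ranges of the parameters: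
    [eps < 1/2] leaves the margin 1/2 - eps for decryption errors, and [delta < 1/2] keeps 1 - 2
    delta positive. *)

(** * Stack programs: relocation, composition, running times *)

Section Programs.
Local Open Scope nat_scope.

Lemma leq_hornern (P : {poly nat}) (x y : nat) : x <= y -> P.[x]%R <= P.[y]%R.
Proof.
move=> lexy; rewrite !horner_coef; apply: leq_sum => i _.
by apply: leq_mul => //; elim: (nat_of_ord i) => // j IH; rewrite !exprS; exact: leq_mul.
Qed.

Fixpoint shift (d : nat) (p : prog) : prog :=
  match p with
  | Skip => Skip
  | Push r b => Push (d + r) b
  | Pop r => Pop (d + r)
  | Seq p q => Seq (shift d p) (shift d q)
  | Case r pe p0 p1 => Case (d + r) (shift d pe) (shift d p0) (shift d p1)
  | While r p => While (d + r) (shift d p)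
  end.

Fixpoint stacks (p : prog) : nat :=
  match p with
  | Skip => 0
  | Push r _ | Pop r => r.+1
  | Seq p q => maxn (stacks p) (stacks q)
  | Case r pe p0 p1 => maxn r.+1 (maxn (stacks pe) (maxn (stacks p0) (stacks p1)))
  | While r p => maxn r.+1 (stacks p)
  end.

Definition graft (d K : nat) (s' s : store) : store :=
  fun r => if d <= r < d + K then s' (r - d) else s r.

Lemma graft_id d K s' s : (forall r, r < K -> s (d + r) = s' r) -> graft d K s' s = s.
Proof.
move=> h; apply: funext => r; rewrite /graft; case: ifP => // /andP[dr rK].
by rewrite -h ?subnKC //; lia.
Qed.

Lemma upd_graft d K s' s r w :
  r < K -> (forall r, r < K -> s (d + r) = s' r) ->
  upd s (d + r) w = graft d K (upd s' r w) s.
Proof.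
move=> rK h; apply: funext => r'; rewrite /graft /upd.
have [->|ne] := eqVneq r' (d + r).
  by rewrite leq_addr ltn_add2l rK addKn !eqxx.
case: ifP => // /andP[dr' r'K]; case: (r' - d =P r) => [e|_]; first by lia.
by rewrite -h ?subnKC //; lia.
Qed.

Lemma graftE d K s' s r : r < K -> graft d K s' s (d + r) = s' r.
Proof. by move=> rK; rewrite /graft leq_addr ltn_add2l rK addKn. Qed.

Lemma graft_graft d K s2 s1 s : graft d K s2 (graft d K s1 s) = graft d K s2 s.
Proof. by apply: funext => r; rewrite /graft; case: ifP => // ->. Qed.

(** A program sees only the stacks below [stacks p], so its run is reproduced, at the same cost, in
    any window that looks like its initial store. The rest of the store survives, which lets several
    programs share one store. *)
Lemma exec_shift p s t s' d K s1 :
  exec p s t s' -> stacks p <= K -> (forall r, r < K -> s1 (d + r) = s r) ->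
  exec (shift d p) s1 t (graft d K s' s1).
Proof.
move=> ex; elim: ex s1 => {p s t s'} /=.
- by move=> s s1 _ h; rewrite graft_id //; exact: ExecSkip.
- move=> r b s s1 rK h; rewrite -h // -upd_graft //; exact: ExecPush.
- move=> r s s1 rK h; rewrite -h // -upd_graft //; exact: ExecPop.
- move=> p q s t s2 t' s3 _ IHp _ IHq s1; rewrite geq_max => /andP[pK qK] h.
  apply: ExecSeq (IHp _ pK h) _; rewrite -(graft_graft d K s3 s2).
  by apply: IHq => // r rK; rewrite graftE.
- move=> r pe p0 p1 s t s2 _ IH s1; rewrite !geq_max => /and4P[rK eK K0 K1] h.
  apply: ExecCase; rewrite h //; move: IH.
  by case: (s r) => [|[] l] IH; apply: IH.
- move=> r p s sr0 s1; rewrite geq_max => /andP[rK pK] h.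
  by rewrite graft_id //; apply: ExecWhileEnd; rewrite h.
- move=> r p s t s2 t' s3 srN _ IHp _ IHw s1; rewrite geq_max => /andP[rK pK] h.
  apply: (ExecWhileStep _ (IHp _ pK h)); first by rewrite h.
  rewrite -(graft_graft d K s3 s2).
  by apply: IHw => [|r' r'K]; rewrite ?geq_max ?rK ?graftE.
Qed.

(** A unit of time adds at most one bit; this turns time bounds into bounds on the length of
    outputs. *)
Lemma exec_size p s t s' r : exec p s t s' -> size (s' r) <= size (s r) + t.
Proof.
elim=> {p s t s'} //=; try by move=> *; lia.
- by move=> r' b s; rewrite /upd; case: eqP => [->|] /=; lia.
- by move=> r' s; rewrite /upd; case: eqP => [->|] /=; rewrite ?size_behead; lia.
Qed.

Definition pour (a b : nat) : prog :=
  While a (Case a Skip (Seq (Pop a) (Push b false)) (Seq (Pop a) (Push b true))).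

(** Each bit costs four units, for the loop test, the case test, the pop and the push; the final
    loop test adds one. *)
Lemma exec_pour a b s : a != b ->
  exec (pour a b) s (4 * size (s a) + 1) (upd (upd s b (rev (s a) ++ s b)) a [::]).
Proof.
move=> ab; move e: (s a) => w; elim: w s e => [|c w IH] s e /=.
  have -> : upd (upd s b (s b)) a [::] = s.
    by apply: funext => r; rewrite /upd; do 2?case: eqP => [->|_].
  exact: ExecWhileEnd.
pose s1 := upd (upd s a w) b (c :: s b).
have s1a : s1 a = w by rewrite /s1 /upd (negPf ab) eqxx.
have s1b : s1 b = c :: s b by rewrite /s1 /upd eqxx.
rewrite (_ : 4 * _ + 1 = ((1 + 1).+1 + (4 * size w + 1)).+1); last by lia.
have -> : upd (upd s b (rev (c :: w) ++ s b)) a [::]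
    = upd (upd s1 b (rev w ++ s1 b)) a [::].
  rewrite s1b rev_cons cat_rcons; apply: funext => r; rewrite /s1 /upd.
  by do 2?case: eqP.
apply: ExecWhileStep (IH _ s1a); first by rewrite e.
apply: ExecCase; rewrite e /s1.
have -> : upd (upd s a w) b (c :: s b)
    = upd (upd s a (behead (s a))) b (c :: upd s a (behead (s a)) b).
  by rewrite e /= [upd s a w b]/upd eq_sym (negPf ab).
by case: c {e IH s1 s1a s1b} => /=; apply: ExecSeq (ExecPop _ _) (ExecPush _ _ _).
Qed.

(* The detour through stack [c] undoes the reversal. *)
Definition transfer (a c b : nat) : prog := Seq (pour a c) (pour c b).

Lemma exec_transfer a c b s : a != c -> c != b -> a != b -> s c = [::] ->
  exec (transfer a c b) s (8 * size (s a) + 2) (upd (upd s a [::]) b (s a ++ s b)).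
Proof.
move=> ac cb ab sc0.
have := exec_pour (upd (upd s c (rev (s a) ++ s c)) a [::]) cb.
rewrite sc0 cats0; have -> : upd (upd s c (rev (s a))) a [::] c = rev (s a).
  by rewrite /upd (eq_sym c) (negPf ac) eqxx.
rewrite size_rev revK => h.
rewrite (_ : 8 * _ + 2 = (4 * size (s a) + 1) + (4 * size (s a) + 1)); last by lia.
apply: ExecSeq (exec_pour _ ac) _; rewrite sc0 cats0.
have -> : upd (upd s a [::]) b (s a ++ s b)
    = upd (upd (upd (upd s c (rev (s a))) a [::]) b
         (s a ++ upd (upd s c (rev (s a))) a [::] b)) c [::].
  rewrite [upd (upd _ _ _) _ _ b]/upd (eq_sym b a) (negPf ab).
  rewrite [upd _ _ _ b]/upd (eq_sym b c) (negPf cb).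
  apply: funext => r; rewrite /upd; have [->|rc] := eqVneq r c.
    by rewrite (negPf cb) (eq_sym c a) (negPf ac).
  by do 2?case: eqP.
exact: h.
Qed.

(** [K] lies above every stack that [p] touches or that holds one of its at most [a.+1] inputs (the
    security parameter comes on top of [a]). Hence it is empty after [p] and serves as scratch, and
    [q] runs on fresh stacks, undisturbed by the leftovers of [p]. *)
Definition compose (a : nat) (p q : prog) : prog :=
  let K := maxn (stacks p) a.+1 in
  Seq p (Seq (transfer 0 K K.+1) (Seq (shift K.+1 q) (transfer K.+1 K 0))).

Lemma exec_frame p s t s' r : exec p s t s' -> stacks p <= r -> s' r = s r.
Proof.
elim=> {p s t s'} //=.
- by move=> r' b s h; rewrite /upd; case: eqP => // e; lia.
- by move=> r' s h; rewrite /upd; case: eqP => // e; lia.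
- by move=> p q s t s1 t' s2 _ IHp _ IHq; rewrite geq_max => /andP[/IHp <- /IHq ->].
- move=> r' pe p0 p1 s t s1 _ IH; rewrite !geq_max => /and4P[_ e0 e1 e2].
  by apply: IH; case: (s r') => [|[]].
- move=> r' p s t s1 t' s2 _ _ IHp _ IHw h; rewrite IHw // IHp //.
  by move: h; rewrite geq_max => /andP[].
Qed.

(** The two transfers cost 8|w| + 2 and 8|out| + 2, and |out| is at most |w| + T2; this is where 9
    and 16 come from. *)
Lemma computes_within_compose a p q ins T1 w T2 out :
  size ins <= a.+1 ->
  computes_within p ins T1 w -> computes_within q [:: w] T2 out ->
  computes_within (compose a p q) ins (T1 + 9 * T2 + 16 * size w + 4) out.
Proof.
move=> insa [t1 [s1 [e1 lt1 s1w]]] [t2 [s2 [e2 lt2 s2o]]]; rewrite /compose.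
set K := maxn _ _.
have K0 : 0 < K by rewrite leq_max orbT.
have emp r : K <= r -> s1 r = [::].
  rewrite geq_max => /andP[pr ar]; rewrite (exec_frame e1 pr) nth_default //.
  exact: leq_trans ar.
have f1 := @exec_transfer 0 K K.+1 s1 _ _ _ (emp _ (leqnn _)).
have {}f1 := f1 ltac:(lia) ltac:(lia) isT.
rewrite (emp _ (leqnSn _)) cats0 s1w in f1.
set s3 := upd _ _ _ in f1.
(* The window has at least one stack, so that it contains the output stack even if [q] touches no
   stack. *)
have s3E r : r < maxn (stacks q) 1 -> s3 (K.+1 + r) = nth [::] [:: w] r.
  move=> _; rewrite /s3 /upd; case: r => [|r] /=; first by rewrite addn0 eqxx.
  rewrite nth_nil; case: eqP => [|_]; first by lia.
  by apply: emp; lia.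
have f2 := exec_shift e2 (leq_maxl _ 1) s3E.
set s4 := graft _ _ _ _ in f2.
have s4K : s4 K = [::].
  rewrite /s4 /graft ltnn /= /s3 /upd; case: eqP => [|_]; first by lia.
  by case: eqP => // _; rewrite emp.
have s40 : s4 0 = [::] by rewrite /s4 /graft ltn0 /= /s3.
have s4o : s4 K.+1 = out.
  by rewrite -[K.+1]addn0 /s4 graftE // leq_max orbT.
have f3 := @exec_transfer K.+1 K 0 s4 _ _ _ s4K.
have {}f3 := f3 ltac:(lia) ltac:(lia) isT.
rewrite s40 cats0 s4o in f3.
exists (t1 + (8 * size w + 2 + (t2 + (8 * size out + 2)))), (upd (upd s4 K.+1 [::]) 0 out).
split=> //.
  exact: ExecSeq e1 (ExecSeq f1 (ExecSeq f2 f3)).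
have := exec_size 0 e2; rewrite s2o /=; lia.
Qed.

Lemma computes_within_size p ins T w : computes_within p ins T w ->
  size w <= sumn (map size ins) + T.
Proof.
move=> [t [s [e lt <-]]]; apply: leq_trans (exec_size 0 e) _; apply: leq_add => //.
by case: ins {e} => //= *; lia.
Qed.

(* Stores as lists: the contents of stacks 0, 1, ..., all other stacks being empty. *)
Definition runs (p : prog) (l : seq bits) (T : nat) (l' : seq bits) : Prop :=
  exists2 t, t <= T & exec p (nth [::] l) t (nth [::] l').

Lemma upd_nth l r w : upd (nth [::] l) r w = nth [::] (set_nth [::] l r w).
Proof. by apply: funext => r'; rewrite /upd nth_set_nth. Qed.

Lemma runs_push r b l : runs (Push r b) l 1 (set_nth [::] l r (b :: nth [::] l r)).
Proof. by exists 1; rewrite // -upd_nth; exact: ExecPush. Qed.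

Lemma runs_pop r l : runs (Pop r) l 1 (set_nth [::] l r (behead (nth [::] l r))).
Proof. by exists 1; rewrite // -upd_nth; exact: ExecPop. Qed.

Lemma runs_seq p q l T1 l1 T2 l2 :
  runs p l T1 l1 -> runs q l1 T2 l2 -> runs (Seq p q) l (T1 + T2) l2.
Proof.
by move=> [t1 l1' e1] [t2 l2' e2]; exists (t1 + t2); [exact: leq_add | exact: ExecSeq e1 e2].
Qed.

Lemma runs_case r pe p0 p1 l T l' :
  runs (if nth [::] l r is b :: _ then (if b then p1 else p0) else pe) l T l' ->
  runs (Case r pe p0 p1) l T.+1 l'.
Proof. by move=> [t lt e]; exists t.+1 => //; exact: ExecCase. Qed.

Lemma runs_while0 r p l : nth [::] l r = [::] -> runs (While r p) l 1 l.
Proof. by exists 1 => //; exact: ExecWhileEnd. Qed.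

Lemma runs_whileS r p l T1 l1 T2 l2 : nth [::] l r <> [::] ->
  runs p l T1 l1 -> runs (While r p) l1 T2 l2 -> runs (While r p) l (T1 + T2).+1 l2.
Proof.
move=> h [t1 l1' e1] [t2 l2' e2]; exists (t1 + t2).+1; first by rewrite ltnS leq_add.
exact: ExecWhileStep h e1 e2.
Qed.

Lemma runs_leq p l T T' l' : T <= T' -> runs p l T l' -> runs p l T' l'.
Proof. by move=> le [t lt e]; exists t => //; exact: leq_trans le. Qed.

Lemma runs_pour a b l : a != b ->
  runs (pour a b) l (4 * size (nth [::] l a) + 1)
    (set_nth [::] (set_nth [::] l b (rev (nth [::] l a) ++ nth [::] l b)) a [::]).
Proof. by move=> ab; exists (4 * size (nth [::] l a) + 1); rewrite // -!upd_nth; exact: exec_pour. Qed.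

Definition drain (r : nat) : prog := While r (Pop r).

Lemma runs_drain r l : runs (drain r) l (2 * size (nth [::] l r) + 1) (set_nth [::] l r [::]).
Proof.
move e: (nth [::] l r) => w; elim: w l e => [|b w IH] l e /=.
  exists 1; rewrite // -upd_nth.
  have -> : upd (nth [::] l) r [::] = nth [::] l.
    by apply: funext => r'; rewrite /upd; case: eqP => [->|].
  exact: ExecWhileEnd.
apply: (@runs_leq _ _ (1 + (2 * size w + 1)).+1); first by lia.
apply: runs_whileS; [by rewrite e | exact: runs_pop |].
have -> : set_nth [::] l r [::] = set_nth [::] (set_nth [::] l r w) r [::].
  by rewrite set_set_nth eqxx.
by rewrite e /=; apply: IH; rewrite nth_set_nth /= eqxx.
Qed.

Fixpoint pushw (r : nat) (w : bits) : prog :=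
  if w is b :: w' then Seq (pushw r w') (Push r b) else Skip.

Lemma exec_pushw r w s : exec (pushw r w) s (size w + 1) (upd s r (w ++ s r)).
Proof.
elim: w => [|b w IH] /=.
  have -> : upd s r (s r) = s by apply: funext => r'; rewrite /upd; case: eqP => [->|].
  exact: ExecSkip.
rewrite -[_.+1 + 1]addn1; apply: ExecSeq; first exact: IH.
have := ExecPush r b (upd s r (w ++ s r)); rewrite [upd _ _ _ r]/upd eqxx.
congr exec; apply: funext => r'; rewrite /upd; by case: eqP.
Qed.

Lemma runs_pushw r w l :
  runs (pushw r w) l (size w + 1) (set_nth [::] l r (w ++ nth [::] l r)).
Proof. by exists (size w + 1); rewrite // -upd_nth; exact: exec_pushw. Qed.

Lemma computes_withinP p ins T l out :
  runs p ins T (out :: l) -> computes_within p ins T out.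
Proof. by move=> [t lt e]; exists t, (nth [::] (out :: l)). Qed.

(** Explicit empty stacks let [nth] and [set_nth] reduce by computation; they leave the store
    unchanged because [nth] defaults to the empty stack. *)
Lemma runs_pad p l k T l' : runs p (l ++ nseq k [::]) T l' -> runs p l T l'.
Proof.
move=> [t lt e]; exists t => //; congr exec: e; apply: funext => r.
by rewrite nth_cat; case: ltnP => // h; rewrite nth_nseq if_same nth_default.
Qed.

End Programs.

(** * Hard-wiring an input into a circuit description *)

Section Attach.
Local Open Scope nat_scope.

Lemma decode_nats_code s w : decode_nats (code_nats s ++ w) = s ++ decode_nats w.
Proof.
rewrite /decode_nats; elim: s => [|n s IH] //=.
by rewrite -catA decode_nats_cat add0n [decode_nats _]IH.
Qed.

Lemma gates_of_natsK g s : gates_of_nats (nats_of_gate g ++ s) = g :: gates_of_nats s.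
Proof. by case: g. Qed.

(* The number of outputs of [decode w]; without a terminating zero, [w] decodes to the
   circuit with no outputs. *)
Definition header (w : bits) : nat := if false \in w then index false w else 0.

Definition payload (w : bits) : bits := drop (index false w).+1 w.

Lemma decode_nats_split (w : bits) :
  decode_nats w = if false \in w then index false w :: decode_nats (payload w) else [::].
Proof.
rewrite /decode_nats /payload.
have gen n v : decode_nats_from n v = if false \in v
    then (n + index false v) :: decode_nats_from 0 (drop (index false v).+1 v) else [::].
  elim: v n => [|[] v IH] n //=; last by rewrite addn0 drop0.
  by rewrite IH in_cons /= addnS addSn.
exact: gen.
Qed.

Lemma outs_decode w : outs (decode w) = header w.
Proof. by rewrite /decode /header decode_nats_split; case: ifP. Qed.

Lemma gates_decode w : gates (decode w) = gates_of_nats (decode_nats (payload w)).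
Proof.
rewrite /decode decode_nats_split; case: ifP => //= /negbT h.
rewrite /payload drop_oversize // ltnW // ltnS leqNgt.
by rewrite index_mem.
Qed.

(* [CX j j] is the identity; it keeps wire [j] in use. *)
Definition init_gate (j : nat) (b : bool) : gate := if b then GX j else CX j j.

(** The accumulator lists the gates in decreasing order of wires: a program that reads [v] from its
    first bit and can only push in front of the code produces this order. *)
Fixpoint init_gates (j : nat) (v : bits) (gs : seq gate) : seq gate :=
  if v is b :: v' then init_gates j.+1 v' (init_gate j b :: gs) else gs.

(* Runs [c] on the hard-wired input [v] and keeps only its first output bit; a
   circuit without outputs is replaced by the constant 0. *)
Definition attach (v : bits) (c : circuit) : circuit :=
  Circuit 1 (if outs c is o.+1 then init_gates 0 v (CX o o :: gates c) else [::]).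

Fixpoint init_code (j : nat) (v : bits) (w : bits) : bits :=
  if v is b :: v' then init_code j.+1 v' (code_nats (nats_of_gate (init_gate j b)) ++ w)
  else w.

(** [attach] on descriptions. Only the leading number of [w] is parsed; the code of the gates is
    kept verbatim behind the new ones, so the program never has to decode a gate. *)
Definition attach_code (v w : bits) : bits :=
  code_nats [:: 1] ++
  if header w is o.+1 then init_code 0 v (code_nats [:: 4; o; o] ++ payload w) else [::].

Lemma gates_init_code j v w gs : gates_of_nats (decode_nats w) = gs ->
  gates_of_nats (decode_nats (init_code j v w)) = init_gates j v gs.
Proof.
elim: v j w gs => [|b v IH] j w gs //= h.
by apply: IH; rewrite decode_nats_code gates_of_natsK h.
Qed.

Lemma decode_attach_code v w : decode (attach_code v w) = attach v (decode w).
Proof.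
rewrite /attach outs_decode gates_decode /attach_code /decode decode_nats_code.
congr Circuit; case: header => [|o] //.
by apply: gates_init_code; rewrite decode_nats_code.
Qed.

(* Stacks 0 and 1 hold the code of the circuit and the string to attach; stack 2 is
   the loop flag, and later the wire index in unary; stacks 3 and 4 receive the number
   of outputs in unary. *)
Definition read_header : prog :=
  While 2 (Case 0 (Seq (Pop 2) (Seq (drain 3) (drain 4)))
                  (Seq (Pop 0) (Pop 2))
                  (Seq (Pop 0) (Seq (Push 3 true) (Push 4 true)))).

Lemma runs_read_header (w v : bits) n :
  let h := if false \in w then n + index false w else 0 in
  runs read_header [:: w; v; [:: true]; unary n; unary n] (9 * size w + 4 * n + 10)
    [:: payload w; v; [::]; unary h; unary h].
Proof.
elim: w n => [|b w IH] n /=.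
  (* The code ended without a terminating zero: both counters are cleared, in accordance with
     [header]. *)
  apply: (@runs_leq _ _ ((1 + ((2 * n + 1) + (2 * n + 1))).+1 + 1).+1); first by lia.
  apply: runs_whileS => //; last exact: runs_while0.
  apply: runs_case => /=; apply: runs_seq; first exact: runs_pop.
  have := runs_drain 3 [:: [::]; v; [::]; unary n; unary n].
  have := runs_drain 4 [:: [::]; v; [::]; [::]; unary n].
  by rewrite /= !size_nseq => h4 h3; exact: runs_seq h3 h4.
case: b => /=; last first.
  apply: (@runs_leq _ _ ((1 + 1).+1 + 1).+1); first by lia.
  apply: runs_whileS => //; last first.
    by rewrite /payload /= drop0 addn0; exact: runs_while0.
  by apply: runs_case; apply: runs_seq; [exact: runs_pop | exact: (runs_pop 2)].
apply: (@runs_leq _ _ ((1 + (1 + 1)).+1 + (9 * size w + 4 * n.+1 + 10)).+1); first by lia.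
apply: runs_whileS => //.
  apply: runs_case; apply: runs_seq; first exact: runs_pop.
  by apply: runs_seq; [exact: (runs_push 3) | exact: (runs_push 4)].
by have := IH n.+1; rewrite /payload /= in_cons /= addSnnS.
Qed.

(** Writes the code of [CX o o] back to front. Each operand consumes one counter, which is why
    [read_header] counts twice, and the pops turn the number [o.+1] of outputs into the wire index
    [o]. *)
Definition widen : prog :=
  Seq (Push 0 false) (Seq (Pop 3) (Seq (pour 3 0)
    (Seq (Push 0 false) (Seq (Pop 4) (Seq (pour 4 0) (pushw 0 (rcons (unary 4) false))))))).

Lemma rev_unary n : rev (unary n) = unary n.
Proof. by rewrite /unary rev_nseq. Qed.

Lemma runs_widen w v o :
  runs widen [:: w; v; [::]; unary o.+1; unary o.+1] (8 * o + 12)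
    [:: code_nats [:: 4; o; o] ++ w; v; [::]; [::]; [::]].
Proof.
have m1 := @runs_pour 3 0 [:: false :: w; v; [::]; unary o; unary o.+1] isT.
have m2 := @runs_pour 4 0
  [:: false :: unary o ++ false :: w; v; [::]; [::]; unary o] isT.
have p := runs_pushw 0 (rcons (unary 4) false)
  [:: unary o ++ false :: unary o ++ false :: w; v; [::]; [::]; [::]].
rewrite /= rev_unary size_nseq in m1 m2.
rewrite /= !cat_rcons -catA /= -catA.
apply: (@runs_leq _ _ (1 + (1 + ((4 * o + 1) + (1 + (1 + ((4 * o + 1) + 6))))))); first by lia.
apply: runs_seq; first exact: runs_push.
apply: runs_seq; first exact: (runs_pop 3).
apply: runs_seq; first exact: m1.
apply: runs_seq; first exact: runs_push.
apply: runs_seq; first exact: (runs_pop 4).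
exact: runs_seq m2 p.
Qed.

(** The index must survive for later gates, so it is duplicated onto stack 3 while it is written and
    restored from there. Reversal by [pour] is harmless on unary strings. *)
Definition emit_index : prog :=
  Seq (While 2 (Seq (Pop 2) (Seq (Push 0 true) (Push 3 true)))) (pour 3 2).

Lemma runs_emit_index w v j :
  runs emit_index [:: w; v; unary j; [::]; [::]] (8 * j + 2)
    [:: unary j ++ w; v; unary j; [::]; [::]].
Proof.
have cons_unary n (u : bits) : true :: unary n ++ u = unary n ++ true :: u.
  by elim: n => //= n ->.
have loop i : runs (While 2 (Seq (Pop 2) (Seq (Push 0 true) (Push 3 true))))
    [:: w; v; unary j; unary i; [::]] (4 * j + 1)
    [:: unary j ++ w; v; [::]; unary (j + i); [::]].
  elim: j i w => [|j IH] i u; first exact: runs_while0.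
  apply: (@runs_leq _ _ ((1 + (1 + 1)) + (4 * j + 1)).+1); first by lia.
  apply: runs_whileS => //.
    apply: runs_seq; first exact: (runs_pop 2).
    apply: runs_seq; [exact: runs_push | exact: (runs_push 3)].
  by have := IH i.+1 (true :: u); rewrite -cons_unary -(addSnnS j i).
apply: (@runs_leq _ _ ((4 * j + 1) + (4 * j + 1))); first by lia.
apply: runs_seq (loop 0) _; rewrite addn0.
have := @runs_pour 3 2 [:: unary j ++ w; v; [::]; unary j; [::]] isT.
by rewrite /= rev_unary cats0 size_nseq.
Qed.

(** Gates are written from their last number to their first: 1, j, 0 for [GX j] and 4, j, j for
    [CX j j], where j is the content of stack 2. *)
Definition init : prog :=
  While 1 (Seq
    (Case 1 Skip
      (Seq (Push 0 false) (Seq emit_index (Seq (Push 0 false) (Seq emit_index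
        (pushw 0 (rcons (unary 4) false))))))
      (Seq (Push 0 false) (Seq (Push 0 false) (Seq emit_index
        (pushw 0 (rcons (unary 1) false))))))
    (Seq (Pop 1) (Push 2 true))).

Lemma runs_init w v j :
  runs init [:: w; v; unary j; [::]; [::]] ((16 * (j + size v) + 16) * size v + 1)
    [:: init_code j v w; [::]; unary (j + size v); [::]; [::]].
Proof.
elim: v j w => [|b v IH] j w; first by rewrite /= muln0 addn0; exact: runs_while0.
apply: (@runs_leq _ _
  (((16 * j + 12).+1 + (1 + 1)) + ((16 * (j.+1 + size v) + 16) * size v + 1)).+1).
  by rewrite /=; nia.
apply: runs_whileS => //; last by rewrite /= -(addSnnS j (size v)); exact: IH.
apply: (@runs_seq _ _ _ _ [:: code_nats (nats_of_gate (init_gate j b)) ++ w; b :: v; unary j; [::]; [::]]); last first.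
  by apply: runs_seq; [exact: (runs_pop 1) | exact: (runs_push 2)].
apply: runs_case => /=; case: b => /=.
  apply: (@runs_leq _ _ (1 + (1 + ((8 * j + 2) + 3)))); first by lia.
  apply: runs_seq; first exact: runs_push.
  apply: runs_seq; first exact: runs_push.
  apply: runs_seq; first exact: runs_emit_index.
  have := runs_pushw 0 (rcons (unary 1) false)
    [:: unary j ++ false :: false :: w; true :: v; unary j; [::]; [::]].
  by rewrite /= cat_rcons -catA.
apply: (@runs_leq _ _ (1 + ((8 * j + 2) + (1 + ((8 * j + 2) + 6))))); first by lia.
apply: runs_seq; first exact: runs_push.
apply: runs_seq; first exact: runs_emit_index.
apply: runs_seq; first exact: runs_push.
apply: runs_seq; first exact: runs_emit_index.
have := runs_pushw 0 (rcons (unary 4) false)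
  [:: unary j ++ false :: unary j ++ false :: w; false :: v; unary j; [::]; [::]].
by rewrite /= !cat_rcons -catA /= -catA.
Qed.

Definition attach_prog : prog :=
  Seq (Push 2 true) (Seq read_header
    (Seq (Case 3 (drain 0) Skip (Seq widen init)) (pushw 0 [:: true; false]))).

(** The time is quadratic because every bit of [v] produces a gate whose wire index is written in
    unary. *)
Lemma computes_attach w v :
  computes_within attach_prog [:: w; v] (33 * (size w + size v + 1) ^ 2) (attach_code v w).
Proof.
set N := size w + size v.
suff [l h] : exists l, runs attach_prog [:: w; v; [::]; [::]; [::]]
    (33 * (N + 1) ^ 2) (attach_code v w :: l).
  exact/(@computes_withinP _ _ _ l)/(@runs_pad _ _ 3).
have hw : header w <= size w by rewrite /header; case: ifP => // _; exact: index_size.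
have [l h] : exists l, runs (Case 3 (drain 0) Skip (Seq widen init))
    [:: payload w; v; [::]; unary (header w); unary (header w)]
    (8 * size w + (16 * size v + 16) * size v + 14)
    ((if header w is o.+1 then init_code 0 v (code_nats [:: 4; o; o] ++ payload w) else [::]) :: l).
  case: (header w) hw => [|o] hw.
    exists [:: v; [::]; [::]; [::]].
    apply: (@runs_leq _ _ (2 * size (payload w) + 1).+1).
      by rewrite /payload size_drop; nia.
    by apply: runs_case; exact: (runs_drain 0).
  exists [:: [::]; unary (size v); [::]; [::]].
  apply: (@runs_leq _ _ ((8 * o + 12) + ((16 * (0 + size v) + 16) * size v + 1)).+1).
    by nia.
  apply: runs_case; apply: runs_seq (runs_widen _ _ _) _.
  exact: (@runs_init _ _ 0).
exists l.
apply: (@runs_leq _ _ (1 + ((9 * size w + 4 * 0 + 10) +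
  ((8 * size w + (16 * size v + 16) * size v + 14) + 3)))).
  by rewrite /N; nia.
apply: runs_seq; first exact: (runs_push 2).
apply: runs_seq; first exact: (@runs_read_header _ _ 0).
apply: runs_seq; first exact: h.
exact: runs_pushw.
Qed.

End Attach.

(** * Polynomial-time generation of the circuits of the attack *)

Section PolynomialTime.
Local Open Scope nat_scope.

(** These evaluation rules are restated with the operations of [nat] on the right-hand side, where
    [lia] can read them. *)
Lemma hornernD (P Q : {poly nat}) (x : nat) : ((P + Q)%R).[x]%R = P.[x]%R + Q.[x]%R.
Proof. exact: hornerD. Qed.

Lemma hornernM (P Q : {poly nat}) (x : nat) : ((P * Q)%R).[x]%R = P.[x]%R * Q.[x]%R.
Proof. exact: hornerM. Qed.

Lemma hornernX (x : nat) : ('X : {poly nat})%R.[x]%R = x.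
Proof. exact: hornerX. Qed.

Lemma hornernC (c x : nat) : ((c%:P)%R : {poly nat}).[x]%R = c.
Proof. exact: hornerC. Qed.

Lemma hornern_comp (P Q : {poly nat}) (x : nat) : ((P \Po Q)%R).[x]%R = P.[Q.[x]]%R.
Proof. exact: horner_comp. Qed.

Definition hornernE := (hornern_comp, hornernD, hornernM, hornernX, hornernC).

Lemma computes_within_leq p ins T T' w :
  T <= T' -> computes_within p ins T w -> computes_within p ins T' w.
Proof. by move=> le [t [s [e lt o]]]; exists t, s; split=> //; exact: leq_trans le. Qed.

Lemma leq_sqrS a b : a <= b -> (a + 1) ^ 2 <= (b + 1) * (b + 1).
Proof. by move=> ab; rewrite -mulnn leq_mul // leq_add2r. Qed.

Lemma generates_attach p a Q : generates p a Q ->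
  exists q, generates q a (fun lam xs => attach [::] (Q lam xs)).
Proof.
move=> [P hP]; exists (compose a p attach_prog).
(* The bound for [compose] with T2 = 33 (|w| + 1)^2 and |w| at most X + P(X); 297 is 9 times 33. *)
exists (P + 297%N%:P * (('X + P + 1%N%:P) * ('X + P + 1%N%:P)) + 16%N%:P * ('X + P) + 4%N%:P)%R.
move=> lam xs sxs; have [w pw Qw] := hP lam xs sxs.
exists (attach_code [::] w); last by rewrite decode_attach_code Qw.
have [t [s [e lt o]]] := computes_attach w [::].
have {}pa : computes_within attach_prog [:: w] (33 * (size w + 0 + 1) ^ 2)
    (attach_code [::] w).
  exists t, s; split=> //; congr exec: e.
  by apply: funext => -[|[|r]]; rewrite /= ?nth_nil.
have sw := computes_within_size pw.
rewrite /= size_nseq in sw.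
apply: computes_within_leq (computes_within_compose _ pw pa); last by rewrite /= sxs.
rewrite !hornernE addn0; move: sw; set X := (lam + _)%N; set Y := (P.[X])%R => sw.
by have := leq_sqrS sw; move: (_ ^ 2) ((_ + 1) * (_ + 1)) => y z; lia.
Qed.

Definition fanout (ds : seq nat) : prog :=
  While 0 (Seq (Pop 0) (foldr (fun r p => Seq (Push r true) p) Skip ds)).

Lemma exec_fanout ds n s : uniq (0 :: ds) -> s 0 = unary n ->
  exec (fanout ds) s ((size ds + 3) * n + 1)
    (fun r => if r == 0 then [::] else if r \in ds then unary n ++ s r else s r).
Proof.
move=> /andP[ds0 uds]; elim: n s => [|n IH] s s0.
  rewrite muln0.
  have -> : (fun r => if r == 0 then [::] else if r \in ds then unary 0 ++ s r else s r) = s.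
    by apply: funext => r; case: eqP => [->|_]; rewrite ?s0 ?if_same.
  exact: ExecWhileEnd.
have push l s' : uniq l ->
    exec (foldr (fun r p => Seq (Push r true) p) Skip l) s' (size l + 1)
      (fun r => if r \in l then true :: s' r else s' r).
  elim: l s' => [|r l IHl] s' /=; first by move=> _; exact: ExecSkip.
  move=> /andP[rl ul]; rewrite -[_.+1 + 1]/(1 + (size l + 1)).
  apply: ExecSeq (ExecPush _ _ _) _.
  congr exec: (IHl (upd s' r (true :: s' r)) ul).
  apply: funext => r'; rewrite in_cons /upd.
  by have [->|ne] /= := eqVneq r' r; rewrite ?(negPf rl).
pose s1 := upd s 0 (behead (s 0)).
have e1 := push ds s1 uds; set s2 := (fun r => if r \in ds then _ else _) in e1.
have s20 : s2 0 = unary n by rewrite /s2 (negPf ds0) /s1 /upd eqxx s0.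
have -> : (fun r => if r == 0 then [::] else if r \in ds then unary n.+1 ++ s r else s r)
    = (fun r => if r == 0 then [::] else if r \in ds then unary n ++ s2 r else s2 r).
  have cons_unary m (u : bits) : true :: unary m ++ u = unary m ++ true :: u.
    by elim: m => //= m ->.
  apply: funext => r; rewrite /s2 /s1 /upd; case: (r =P 0) => // _.
  by case: (r \in ds) => //=; rewrite cons_unary.
rewrite (_ : _ * _ + 1 = ((1 + (size ds + 1)) + ((size ds + 3) * n + 1)).+1); last by lia.
apply: ExecWhileStep (IH _ s20); first by rewrite s0.
exact: ExecSeq (ExecPop _ _) e1.
Qed.

(** The first stage of the adversary: the messages 0...0 and 10...0 side by side differ from the
    all-zero register in wire [f lam] only. The length occurs three times in the code, twice in the
    number of outputs and once as wire index, hence three copies. *)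
Lemma generates_flip f : ptime (fun lam => unary (f lam)) ->
  qpt 0 (fun lam _ => Circuit (f lam + f lam) [:: GX (f lam)]).
Proof.
move=> [p [P hP]]; exists (compose 0 p (Seq (fanout [:: 1; 2; 3])
  (Seq (pushw 0 [:: false; false]) (Seq (pour 1 0)
    (Seq (pushw 0 [:: false; true; false]) (Seq (pour 2 0) (pour 3 0))))))).
(* The printing program takes 18 m + 12 units; [compose] multiplies them by 9 and adds 4, which
   gives 162 and 112. *)
exists (P + 162%N%:P * ('X + P) + 16%N%:P * ('X + P) + 112%N%:P)%R => lam [] // _.
exists (encode (Circuit (f lam + f lam) [:: GX (f lam)])); last first.
  by rewrite -[encode _]cats0 (encodeK _ 0).
have := hP lam; rewrite addn0; move: (f lam) => m h.
have sm := computes_within_size h; rewrite /= !size_nseq addn0 in sm.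
apply: computes_within_leq; last first.
  apply: (@computes_within_compose _ _ _ [:: unary lam] _ _ (18 * m + 12) _ _ h) => //.
  apply: (@computes_withinP _ _ _ [:: [::]; [::]; [::]]).
  have f1 : runs (fanout [:: 1; 2; 3]) [:: unary m] (6 * m + 1) [:: [::]; unary m; unary m; unary m].
    exists (6 * m + 1) => //.
    have := @exec_fanout [:: 1; 2; 3] m (nth [::] [:: unary m]) isT erefl.
    congr exec; apply: funext => -[|[|[|[|r]]]] //=; by rewrite ?cats0 ?nth_nil.
  have m1 := @runs_pour 1 0 [:: [:: false; false]; unary m; unary m; unary m] isT.
  have m2 := @runs_pour 2 0
    [:: false :: true :: false :: unary m ++ [:: false; false]; [::]; unary m; unary m] isT.
  have m3 := @runs_pour 3 0
    [:: unary m ++ false :: true :: false :: unary m ++ [:: false; false]; [::]; [::]; unary m] isT.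
  rewrite /= !rev_unary !size_nseq in m1 m2 m3.
  apply: (@runs_leq _ _ ((6 * m + 1) + (3 + ((4 * m + 1) + (4 + ((4 * m + 1) + (4 * m + 1)))))));
    first by lia.
  apply: runs_seq; first exact: f1.
  apply: runs_seq; first exact: runs_pushw.
  apply: runs_seq; first exact: m1.
  apply: runs_seq; first exact: runs_pushw.
  apply: runs_seq; first exact: m2.
  have uD : unary (m + m) = unary m ++ unary m by exact: nseqD.
  rewrite /encode /= /code_nats /= !cat_rcons uD -catA.
  exact: m3.
by rewrite /= !hornernE !size_nseq; lia.
Qed.

(** The last stage of the adversary. Its strings arrive on stacks 1 and 2, behind the security
    parameter, so [attach_prog] is shifted by one and its output moved to the cleared stack 0. *)
Lemma generates_attach_decode :
  qpt 2 (fun _ xs => attach (nth [::] xs 1) (decode (nth [::] xs 0))).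
Proof.
pose K := stacks attach_prog.
exists (Seq (drain 0) (Seq (shift 1 attach_prog) (transfer 1 K.+1 0))).
exists (297%N%:P * (('X + 1%N%:P) * ('X + 1%N%:P)) + 10%N%:P * 'X + 4%N%:P)%R.
move=> lam [|st [|dk []]] // _; exists (attach_code dk st); last by rewrite decode_attach_code.
have [t0 lt0 e0] := runs_drain 0 [:: unary lam; st; dk].
have [t [s [e lt o]]] := computes_attach st dk.
have e1 := @exec_shift _ _ _ _ 1 K (nth [::] [:: [::]; st; dk]) e (leqnn _).
have {}e1 := e1 (fun r _ => erefl).
set s1 := graft _ _ _ _ in e1.
have s11 : s1 1 = attach_code dk st by rewrite -o /s1 -[1 in LHS]addn0 graftE.
have s1K : s1 K.+1 = [::] by rewrite /s1 /graft ltnn andbF.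
have e2 := @exec_transfer 1 K.+1 0 s1 isT isT isT s1K.
exists (t0 + (t + (8 * size (s1 1) + 2))), (upd (upd s1 1 [::]) 0 (s1 1 ++ s1 0)).
split; first exact: ExecSeq e0 (ExecSeq e1 e2).
  have := exec_size 0 e; rewrite o s11 /= => so.
  rewrite /= size_nseq in lt0.
  rewrite !hornernE /= addn0.
  have := @leq_sqrS (size st + size dk) (lam + (size st + size dk)) (leq_addl _ _).
  by move: lt; move: (_ ^ 2) ((_ + 1) * (_ + 1)) => y z; lia.
by rewrite /upd eqxx s11 /s1 /graft /= cats0.
Qed.

(** Prepares the six inputs of the tomography program: [lam] itself, two lengths computed from
    copies of [lam], and three fixed strings for the data that do not vary with [lam]. The final
    [shift 0 T] moves nothing; it makes [exec_shift] applicable, so that [T] may run although the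
    stacks from [K] on hold leftovers. *)
Lemma generates_preprocess (T : prog) (f g : nat -> nat) (u0 u4 u5 : bits)
    (P : {poly nat}) (k1 k2 : nat) (Q : nat -> bits) :
  ptime (fun lam => unary (f lam)) -> ptime (fun lam => unary (g lam)) ->
  (forall lam, computes_within T
     [:: u0; unary lam; unary (f lam); unary (g lam); u4; u5]
     (P.[(lam + f lam + g lam + k1 + k2)%N])%R (Q lam)) ->
  qpt 0 (fun lam _ => decode (Q lam)).
Proof.
move=> [pf [Pf hf]] [pg [Pg hg]] hT.
(* Three disjoint windows: [K] stacks for [T] with its six inputs, then one for each length program,
   large enough to contain its output stack. *)
pose K := maxn 6 (stacks T); pose Kf := (stacks pf).+1; pose Kg := (stacks pg).+1.
pose df := K; pose dg := K + Kf.
exists (Seq (fanout [:: 1; df; dg]) (Seq (shift df pf) (Seq (shift dg pg)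
  (Seq (pour df 2) (Seq (pour dg 3)
    (Seq (pushw 0 u0) (Seq (pushw 4 u4) (Seq (pushw 5 u5) (shift 0 T))))))))).
exists (P \Po ('X + ('X + Pf) + ('X + Pg) + k1%:P + k2%:P)
  + 14%N%:P * 'X + 5%N%:P * Pf + 5%N%:P * Pg
  + (size u0 + size u4 + size u5 + 6)%N%:P)%R.
move=> lam [] // _; exists (Q lam) => //; rewrite addn0.
have [tf [sf [ef ltf of_]]] := hf lam; have [tg [sg [eg ltg og]]] := hg lam.
have [tT [sT [eT ltT oT]]] := hT lam.
have K6 : 6 <= K by exact: leq_maxl.
have dfE : df = K by []. have dgE : dg = K + Kf by [].
have Kf0 : 0 < Kf by []. have Kg0 : 0 < Kg by [].
have e1 := @exec_fanout [:: 1; df; dg] lam (nth [::] [:: unary lam]).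
have {}e1 : exec _ _ _ _ := e1 ltac:(by rewrite /= !inE; lia) erefl.
set s1 := (fun r => _) in e1.
have s1f r : r < Kf -> s1 (df + r) = nth [::] [:: unary lam] r.
  move=> rK; rewrite /s1 !inE; case: r rK => [|r] rK; rewrite ?nth_nil.
    rewrite addn0 eqxx orbT; case: eqP => [|_]; first by lia.
    by rewrite nth_default ?cats0 //=; lia.
  by do ?[case: eqP => [?|_]; first by lia]; rewrite nth_default /= ?nth_nil //; lia.
have e2 := exec_shift ef (leqnSn _) s1f.
set s2 := graft _ _ _ _ in e2.
have s2g r : r < Kg -> s2 (dg + r) = nth [::] [:: unary lam] r.
  move=> rK; rewrite /s2 /graft; case: ifP => [|_]; first by lia.
  rewrite /s1 !inE; case: r rK => [|r] rK; rewrite ?nth_nil.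
    rewrite addn0 eqxx !orbT; case: eqP => [|_]; first by lia.
    by rewrite nth_default ?cats0 //=; lia.
  by do ?[case: eqP => [?|_]; first by lia]; rewrite nth_default /= ?nth_nil //; lia.
have e3 := exec_shift eg (leqnSn _) s2g.
set s3 := graft _ _ _ _ in e3.
have s3f : s3 df = unary (f lam).
  rewrite -of_ /s3 /graft; case: ifP => [|_]; first by lia.
  by rewrite -[df]addn0 /s2 graftE.
have s3g : s3 dg = unary (g lam) by rewrite -og -[dg]addn0 /s3 graftE.
have s3s r : r < K -> s3 r = if r == 1 then unary lam else [::].
  move=> rK; rewrite /s3 /graft; case: ifP => [|_]; first by lia.
  rewrite /s2 /graft; case: ifP => [|_]; first by lia.
  rewrite /s1 !inE; case: r rK => [|[|r]] rK //=; first by rewrite cats0.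
  by do ?[case: eqP => [?|_]; first by lia]; rewrite /= ?nth_nil.
have e4 := @exec_pour df 2 s3 ltac:(lia).
set s4 := upd _ _ _ in e4.
have s4g : s4 dg = unary (g lam).
  by rewrite /s4 /upd; do ?[case: eqP => [?|_]; first by lia].
have e5 := @exec_pour dg 3 s4 ltac:(lia).
set s5 := upd _ _ _ in e5.
have e6 := exec_pushw 0 u0 s5; set s6 := upd s5 _ _ in e6.
have e7 := exec_pushw 4 u4 s6; set s7 := upd s6 _ _ in e7.
have e8 := exec_pushw 5 u5 s7; set s8 := upd s7 _ _ in e8.
have s8E r : r < K -> s8 (0 + r)
    = nth [::] [:: u0; unary lam; unary (f lam); unary (g lam); u4; u5] r.
  move=> rK; rewrite add0n /s8 /s7 /s6 /s5 s4g /s4 s3f /upd !rev_unary.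
  case: r rK => [|[|[|[|[|[|r]]]]]] rK; 
    do ?[case: (_ =P df) => [?|_]; first by lia];
    do ?[case: (_ =P dg) => [?|_]; first by lia]; rewrite /= ?s3s //= ?cats0 //.
  by rewrite nth_nil.
have e9 := exec_shift eT (leq_maxr 6 _) s8E.
exists (((3 + 3) * lam + 1) + (tf + (tg + ((4 * size (s3 df) + 1) + ((4 * size (s4 dg) + 1)
  + ((size u0 + 1) + ((size u4 + 1) + ((size u5 + 1) + tT)))))))), (graft 0 K sT s8).
split; last by rewrite -oT; apply: (@graftE 0); lia.
  exact: ExecSeq e1 (ExecSeq e2 (ExecSeq e3 (ExecSeq e4 (ExecSeq e5
    (ExecSeq e6 (ExecSeq e7 (ExecSeq e8 e9))))))).
have := exec_size 0 ef; have := exec_size 0 eg.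
rewrite s3f s4g og of_ /= !size_nseq => lg lf.
rewrite !hornernE.
(* The lengths are at most [lam] plus the time taken to print them, and polynomials over the
   naturals are monotone. *)
suff h : (P.[(lam + f lam + g lam + k1 + k2)%N])%R
     <= (P.[(lam + (lam + Pf.[lam]%R) + (lam + Pg.[lam]%R) + k1 + k2)%N])%R by lia.
by apply: leq_hornern; lia.
Qed.

End PolynomialTime.

(** * Positivity and trace under circuits *)

Section Quantum.
Variable R : realType.
Local Notation C := R[i].
Implicit Types (rho sigma : op R) (n m N : nat) (s : bits).

(* A sum of rank-one terms: unlike positivity, visibly stable under tensor products. *)
Definition gram rho : Prop :=
  exists l : seq (bits -> C), forall x y, rho x y = \sum_(f <- l) f x * (f y)^*.

Definition trace N rho : C := \sum_(x : N.-tuple bool) rho x x.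

Definition state n rho : Prop := gram rho /\ trace n rho = 1.

Lemma sum_tuple0 (V : nmodType) (F : bits -> V) : \sum_(x : 0.-tuple bool) F x = F [::].
Proof. by rewrite (bigD1 [tuple]) //= big1 ?addr0 // => t; rewrite tuple0. Qed.

Lemma sum_tuple_cons (V : nmodType) n (F : bits -> V) :
  \sum_(x : n.+1.-tuple bool) F x = \sum_(b : bool) \sum_(x : n.-tuple bool) F (b :: x).
Proof.
rewrite pair_big /=; rewrite (reindex (fun p : bool * n.-tuple bool => [tuple of p.1 :: p.2])) //=.
exists (fun t : n.+1.-tuple bool => (thead t, [tuple of behead t])).
  by move=> [b t] _ /=; congr pair; apply: val_inj.
by move=> t _; rewrite [t in RHS]tuple_eta; apply: val_inj.
Qed.

Lemma sum_tuple_cat (V : nmodType) n m N (F : bits -> V) : N = (n + m)%N ->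
  \sum_(x : N.-tuple bool) F x
    = \sum_(x : n.-tuple bool) \sum_(y : m.-tuple bool) F (x ++ y).
Proof.
move=> ->; elim: n F => [|n IH] F.
  by rewrite (sum_tuple0 (fun x => \sum_(y : m.-tuple bool) F (x ++ y))).
rewrite (sum_tuple_cons (n + m) F).
rewrite (sum_tuple_cons n (fun x => \sum_(y : m.-tuple bool) F (x ++ y))).
by apply: eq_bigr => b _; rewrite (IH (fun x => F (b :: x))).
Qed.

Lemma sum_tuple1 (V : nmodType) n s (F : bits -> V) : size s = n ->
  (forall x : n.-tuple bool, val x != s -> F x = 0) -> \sum_(x : n.-tuple bool) F x = F s.
Proof.
move=> /eqP sn h; rewrite (bigD1 (Tuple sn)) //= big1 ?addr0 // => x xs; exact: h.
Qed.

Lemma conj_sum (I : Type) (r : seq I) (F : I -> C) :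
  (\sum_(i <- r) F i)^* = \sum_(i <- r) (F i)^*.
Proof. exact: rmorph_sum. Qed.

Lemma gram_basis s : gram (basis R s).
Proof.
exists [:: fun x => (x == s)%:R] => x y.
by rewrite big_seq1 /basis conjC_nat -natrM mulnb.
Qed.

Lemma gram_tens n rho sigma : gram rho -> gram sigma -> gram (tens n rho sigma).
Proof.
move=> [l hl] [l' hl'].
exists [seq (fun x => f (take n x) * g (drop n x)) | f <- l, g <- l'] => x y.
rewrite /tens hl hl' big_allpairs_dep mulr_suml; apply: eq_bigr => f _.
rewrite mulr_sumr; apply: eq_bigr => g _.
by rewrite rmorphM /=; ring.
Qed.

Lemma gram_tens_pow n k rho : gram rho -> gram (tens_pow n k rho).
Proof. by move=> h; elim: k => [|k IH]; [exact: gram_basis | exact: gram_tens]. Qed.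

Lemma gram_conj1 u j rho : gram rho -> gram (conj1 u j rho).
Proof.
move=> [l hl]; exists [seq (fun x => \sum_(a : bool) u (nth false x j) a * f (set_bit x j a)) | f <- l].
move=> x y; rewrite big_map /conj1.
transitivity (\sum_(f <- l) \sum_(a : bool) \sum_(b : bool)
    u (nth false x j) a * (f (set_bit x j a) * (f (set_bit y j b))^* )
      * (u (nth false y j) b)^* ).
  rewrite [RHS]exchange_big /=; apply: eq_bigr => a _.
  rewrite [RHS]exchange_big /=; apply: eq_bigr => b _.
  by rewrite hl mulr_sumr mulr_suml.
apply: eq_bigr => f _; rewrite conj_sum mulr_suml; apply: eq_bigr => a _.
by rewrite mulr_sumr; apply: eq_bigr => b _; rewrite rmorphM /=; ring.
Qed.

Lemma gram_gates gs rho : gram rho -> gram (foldl (@apply_gate R) rho gs).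
Proof.
elim: gs rho => [|g gs IH] rho h //=; apply: IH.
case: g => [j|j|j|c t] /=; try exact: gram_conj1.
by case: h => l hl; exists [seq f \o cnot c t | f <- l] => x y; rewrite big_map hl.
Qed.

Lemma gram_channel n c rho : gram rho -> gram (channel n c rho).
Proof.
move=> h; rewrite /channel.
have [l hl] := gram_gates (gates c) (gram_tens n h (gram_basis (nseq (width n c - n) false))).
(* Tracing out preserves the form: each vector is replaced by its slices, one for each value of the
   discarded wires. *)
exists [seq (fun x => f (x ++ tval t)) | t <- enum {: (width n c - outs c).-tuple bool}, f <- l].
move=> x y; rewrite big_allpairs_dep big_enum /=; apply: eq_bigr => t _.
by rewrite hl.
Qed.

Lemma trace_basis s N : size s = N -> trace N (basis R s) = 1.
Proof.
move=> sN; rewrite /trace /basis.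
rewrite (@sum_tuple1 _ _ s (fun x => ((x == s) && (x == s))%:R)) ?eqxx //.
by move=> x /negPf ->.
Qed.

Lemma trace_tens n m N rho sigma : N = (n + m)%N ->
  trace N (tens n rho sigma) = trace n rho * trace m sigma.
Proof.
move=> e; rewrite /trace (sum_tuple_cat (fun x => tens n rho sigma x x) e) mulr_suml.
apply: eq_bigr => x _; rewrite mulr_sumr; apply: eq_bigr => y _.
by rewrite /tens take_size_cat ?drop_size_cat ?size_tuple.
Qed.

Lemma trace_tens_pow n k rho : trace n rho = 1 -> trace (k * n) (tens_pow n k rho) = 1.
Proof.
move=> h; elim: k => [|k IH] /=; first by rewrite trace_basis.
by rewrite (@trace_tens n (k * n)) ?mulSn // h IH mulr1.
Qed.

Lemma size_set_bit N x j b : (j < N)%N -> size x = N -> size (set_bit x j b) = N.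
Proof. by move=> jN sx; rewrite /set_bit size_set_nth sx; apply/maxn_idPr. Qed.

Lemma size_cnot N x c t : (maxn c.+1 t.+1 <= N)%N -> size x = N -> size (cnot c t x) = N.
Proof. by rewrite geq_max /cnot => /andP[cN tN] sx; case: eqP => // _; exact: size_set_bit. Qed.

Lemma cnotK N x c t : (maxn c.+1 t.+1 <= N)%N -> size x = N -> cnot c t (cnot c t x) = x.
Proof.
rewrite geq_max /cnot /set_bit => /andP[cN tN] sx; case: eqP => // /eqP ct.
apply: (@eq_from_nth _ false).
  by rewrite !size_set_nth sx; lia.
move=> i _; rewrite !nth_set_nth /= !nth_set_nth /= eqxx (negPf ct).
by case: eqP => [->|_]; rewrite -?addbA ?addbb ?addbF.
Qed.

(** Overwriting bit [j] with both values meets every string twice, from itself and from its flip.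
    Doubling the sum avoids splitting labels into prefix, bit and suffix. *)
Lemma sum_set_bit (V : nmodType) N j (F : bits -> V) : (j < N)%N ->
  (\sum_(x : N.-tuple bool) F x) *+ 2
    = \sum_(x : N.-tuple bool) \sum_(b : bool) F (set_bit x j b).
Proof.
move=> jN.
pose fl (x : N.-tuple bool) : N.-tuple bool :=
  insubd x (set_bit x j (~~ nth false x j)).
have flE x : val (fl x) = set_bit x j (~~ nth false x j).
  by rewrite /fl val_insubd (@size_set_bit N) ?size_tuple ?eqxx.
have flK : involutive fl.
  move=> x; apply: val_inj; rewrite !flE /set_bit; apply: (@eq_from_nth _ false).
    by rewrite !size_set_nth size_tuple; lia.
  move=> i _; rewrite !nth_set_nth /= !nth_set_nth /= eqxx.
  by case: eqP => // ->; rewrite negbK.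
rewrite mulr2n [X in _ + X](reindex_inj (inv_inj flK)) /= -big_split /=.
apply: eq_bigr => x _; rewrite flE big_bool /=.
have e : set_bit x j (nth false x j) = x.
  apply: (@eq_from_nth _ false); first by rewrite (@size_set_bit N) ?size_tuple.
  by move=> i _; rewrite nth_set_nth /=; case: eqP => [->|].
by move: e; case: (nth false x j) => e; rewrite -{1}e // addrC.
Qed.

(** Grouped by the bits off wire [j], the trace is a sum of traces of 2 by 2 blocks conjugated by
    [u]. The hypothesis says that the columns of [u] are orthonormal, so each block keeps its trace;
    the factor 2 from [sum_set_bit] is cancelled. *)
Lemma trace_conj1 (u : bool -> bool -> C) N j rho :
  (forall a b, \sum_(c : bool) u c a * (u c b)^* = (a == b)%:R) ->
  (j < N)%N -> trace N (conj1 u j rho) = trace N rho.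
Proof.
move=> hu jN; have two0 : (2%:R : C) != 0 by rewrite pnatr_eq0.
apply: (mulIf two0); rewrite !mulr_natr /trace.
rewrite (sum_set_bit (fun x => conj1 u j rho x x) jN) (sum_set_bit (fun x => rho x x) jN).
apply: eq_bigr => x _; rewrite /conj1.
have set2 a b : set_bit (set_bit x j a) j b = set_bit x j b.
  by rewrite /set_bit set_set_nth eqxx.
have nthb a : nth false (set_bit x j a) j = a by rewrite nth_set_nth /= eqxx.
transitivity (\sum_(a : bool) \sum_(b : bool)
    (\sum_(c : bool) u c a * (u c b)^* ) * rho (set_bit x j a) (set_bit x j b)).
  rewrite exchange_big /=; apply: eq_bigr => a _.
  rewrite exchange_big /=; apply: eq_bigr => b _.
  rewrite mulr_suml; apply: eq_bigr => c _.
  by rewrite nthb !set2 mulrAC.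
apply: eq_bigr => a _; rewrite big_bool /= !hu.
by case: a => /=; rewrite ?mul0r ?mul1r ?addr0 ?add0r.
Qed.

Lemma conj_sqrtC2 : ((sqrtC 2%:R : C)^-1)^* = (sqrtC 2%:R)^-1.
Proof. by rewrite geC0_conj // invr_ge0 sqrtC_ge0 ler0n. Qed.

Lemma sqrtC2_sqr : ((sqrtC 2%:R : C)^-1) * (sqrtC 2%:R)^-1 = 2%:R^-1.
Proof. by rewrite -invfM -expr2 sqrtCK. Qed.

Lemma unitary_X a b : \sum_(c : bool) mxX R c a * (mxX R c b)^* = (a == b)%:R.
Proof. by rewrite big_bool /mxX !conjC_nat; case: a; case: b; rewrite /= ?mulr0 ?mulr1 ?addr0 ?add0r. Qed.

Lemma unitary_H a b : \sum_(c : bool) mxH R c a * (mxH R c b)^* = (a == b)%:R.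
Proof.
have half2 : 2%:R^-1 + 2%:R^-1 = 1 :> C by have := splitr (1 : C); rewrite !mul1r.
rewrite big_bool /mxH; move: conj_sqrtC2 sqrtC2_sqr.
set r := (sqrtC _)^-1 => cr r2.
have cN : (- r)^* = - r by rewrite rmorphN /= cr.
by case: a; case: b; rewrite /= ?expr0 ?expr1 ?mulN1r ?mul1r ?cN ?cr ?mulrN ?mulNr ?opprK ?r2
  ?half2 ?subrr ?addNr.
Qed.

Lemma unitary_T a b : \sum_(c : bool) mxT R c a * (mxT R c b)^* = (a == b)%:R.
Proof.
rewrite big_bool /mxT; case: a; case: b;
  rewrite /= ?mul0r ?mulr0 ?add0r ?addr0 ?rmorph0 ?rmorph1 ?mulr0 ?mulr1 ?mul1r //.
  rewrite rmorphM /= conj_sqrtC2 rmorphD rmorph1 /= conjCi mulrACA sqrtC2_sqr.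
  rewrite [(1 + _) * _]mulrC -subr_sqr expr1n sqrCi opprK -[1 + 1]/(2%:R).
  by rewrite mulfV // pnatr_eq0.
exact: rmorph1.
Qed.

Lemma trace_gate g N rho : (reach g <= N)%N -> trace N (apply_gate rho g) = trace N rho.
Proof.
case: g => [j|j|j|c t] /= h.
- exact: trace_conj1 unitary_X h.
- exact: trace_conj1 unitary_H h.
- exact: trace_conj1 unitary_T h.
rewrite /trace; pose f (x : N.-tuple bool) : N.-tuple bool := insubd x (cnot c t x).
have fE x : val (f x) = cnot c t x by rewrite /f val_insubd (size_cnot h) ?size_tuple ?eqxx.
have fK : involutive f.
  by move=> x; apply: val_inj; rewrite !fE (cnotK h) ?size_tuple.
rewrite [RHS](reindex_inj (inv_inj fK)) /=.
by apply: eq_bigr => x _; rewrite fE.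
Qed.

Lemma trace_gates gs N rho : (\max_(g <- gs) reach g <= N)%N ->
  trace N (foldl (@apply_gate R) rho gs) = trace N rho.
Proof.
elim: gs rho => [|g gs IH] rho //=; rewrite big_cons geq_max => /andP[gN gsN].
by rewrite IH // trace_gate.
Qed.

Lemma trace_channel n c rho : trace (outs c) (channel n c rho) = trace n rho.
Proof.
have le : [&& (n <= width n c)%N, (outs c <= width n c)%N &
    (\max_(g <- gates c) reach g <= width n c)%N].
  by rewrite /width !leq_max !leqnn !orbT.
case/and3P: le => nN oN gN; rewrite /channel; set N := width n c in nN oN gN *.
have := trace_gates (tens n rho (basis R (nseq (N - n) false))) gN.
rewrite (@trace_tens n (N - n)) ?subnKC // trace_basis ?size_nseq // mulr1 => <-.
rewrite [RHS]/trace; set out := foldl _ _ _.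
by rewrite (sum_tuple_cat (fun x => out x x) (esym (subnKC oN))).
Qed.

Lemma state_channel n c rho : state n rho -> state (outs c) (channel n c rho).
Proof. by move=> [g t]; split; [exact: gram_channel | rewrite trace_channel]. Qed.

Lemma state_tens_pow n k rho : state n rho -> state (k * n) (tens_pow n k rho).
Proof. by move=> [g t]; split; [exact: gram_tens_pow | exact: trace_tens_pow]. Qed.

Lemma state_basis s n : size s = n -> state n (basis R s).
Proof. by move=> sn; split; [exact: gram_basis | exact: trace_basis]. Qed.

(** The quadratic form is a sum of squared moduli of inner products with the vectors of the
    decomposition. This makes the tomography guarantee, stated for density operators, available for
    ciphertexts. *)
Lemma state_density n rho : state n rho -> density n rho.
Proof.
move=> [[l hl] t]; split=> // v.
rewrite [leRHS](_ : _ = \sum_(f <- l) `|\sum_(x : n.-tuple bool) (v x)^* * f x| ^+ 2).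
  by apply: sumr_ge0 => f _; rewrite exprn_ge0.
transitivity (\sum_(f <- l) \sum_(x : n.-tuple bool) \sum_(y : n.-tuple bool)
    (v x)^* * (f x * (f y)^* ) * v y).
  rewrite [RHS]exchange_big /=; apply: eq_bigr => x _.
  rewrite [RHS]exchange_big /=; apply: eq_bigr => y _.
  by rewrite hl mulr_sumr mulr_suml.
apply: eq_bigr => f _; rewrite normCK conj_sum mulr_suml; apply: eq_bigr => x _.
by rewrite mulr_sumr; apply: eq_bigr => y _; rewrite rmorphM /= conjCK; ring.
Qed.

Lemma gram_diag_ge0 rho x : gram rho -> 0 <= rho x x.
Proof. by case=> l ->; apply: sumr_ge0 => f _; exact: mul_conjC_ge0. Qed.

Lemma Re_ge0 (z : C) : 0 <= z -> 0 <= complex.Re z.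
Proof. by case: z => a b; rewrite lecE /= => /andP[]. Qed.

Lemma Re_sum (I : finType) (P : pred I) (F : I -> C) :
  complex.Re (\sum_(i | P i) F i) = \sum_(i | P i) complex.Re (F i).
Proof. by apply: (big_morph (@complex.Re R)) => // -[a b] [c d]. Qed.

Lemma Pr_ge0 n c rho y : gram rho -> 0 <= Pr n c rho y.
Proof. by move=> h; apply/Re_ge0/gram_diag_ge0/gram_channel. Qed.

Lemma sum_Pr n c rho : trace n rho = 1 ->
  \sum_(y : (outs c).-tuple bool) Pr n c rho y = 1.
Proof. by move=> h; rewrite -Re_sum -/(trace _ _) trace_channel h. Qed.

End Quantum.

(** * Output probabilities of circuits with hard-wired input *)

Section AttachSemantics.
Variable R : realType.
Implicit Types (rho sigma : op R) (s v : bits).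

(** Equality on labels of the right length is the most one can ask for: [set_bit] pads shorter
    labels, and the action of a bit flip on basis states fails there. *)
Definition agree N rho sigma : Prop :=
  forall x y, size x = N -> size y = N -> rho x y = sigma x y.

Lemma agree_gate N g rho sigma : (reach g <= N)%N -> agree N rho sigma ->
  agree N (apply_gate rho g) (apply_gate sigma g).
Proof.
move=> gN h; case: g gN => [j|j|j|c t] /= gN x y sx sy; last by apply: h; exact: size_cnot.
all: by apply: eq_bigr => a _; apply: eq_bigr => b _; rewrite h //; exact: size_set_bit.
Qed.

Lemma agree_gates N gs rho sigma : (\max_(g <- gs) reach g <= N)%N -> agree N rho sigma ->
  agree N (foldl (@apply_gate R) rho gs) (foldl (@apply_gate R) sigma gs).
Proof.
elim: gs rho sigma => [|g gs IH] rho sigma //=; rewrite big_cons geq_max => /andP[gN gsN] h.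
by apply: IH => //; exact: agree_gate.
Qed.

Lemma apply_CXid rho j : apply_gate rho (CX j j) = rho.
Proof. by apply: funext => x; apply: funext => y; rewrite /= /cnot eqxx. Qed.

Lemma apply_GX rho j x y : apply_gate rho (GX j) x y
  = rho (set_bit x j (~~ nth false x j)) (set_bit y j (~~ nth false y j)).
Proof.
have sum2 c (F : bool -> R[i]) : \sum_(a : bool) mxX R c a * F a = F (~~ c).
  by rewrite big_bool /mxX; case: c; rewrite /= ?mul0r ?mul1r ?addr0 ?add0r.
have sum2' d (F : bool -> R[i]) : \sum_(a : bool) F a * (mxX R d a)^* = F (~~ d).
  by rewrite -[RHS]sum2; apply: eq_bigr => a _; rewrite mulrC /mxX conjC_nat.
rewrite /= /conj1.
under eq_bigr => a _ do rewrite (sum2' _ (fun b => mxX R _ a * rho _ (set_bit y j b))).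
exact: (sum2 _ (fun a => rho (set_bit x j a) _)).
Qed.

Lemma set_bit_cat u v b c : set_bit (u ++ c :: v) (size u) b = u ++ b :: v.
Proof. by rewrite /set_bit; elim: u => //= a l ->. Qed.

Lemma nth_size_cat u v b : nth false (u ++ b :: v) (size u) = b.
Proof. by rewrite nth_cat ltnn subnn. Qed.

Lemma apply_GX_basis N (u v : bits) b : N = (size u + (size v).+1)%N ->
  agree N (apply_gate (basis R (u ++ b :: v)) (GX (size u))) (basis R (u ++ ~~ b :: v)).
Proof.
move=> eN x y sx sy; rewrite apply_GX /basis.
have uN : (size u < N)%N by lia.
have flipE z : size z = N -> (set_bit z (size u) (~~ nth false z (size u)) == u ++ b :: v)
    = (z == u ++ ~~ b :: v).
  move=> sz; apply/eqP/eqP => [e|->]; last by rewrite nth_size_cat negbK set_bit_cat.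
  have zb : ~~ nth false z (size u) = b.
    by rewrite -(nth_size_cat u v b) -e nth_set_nth /= eqxx.
  have <- : set_bit (u ++ b :: v) (size u) (~~ b) = u ++ ~~ b :: v by rewrite set_bit_cat.
  rewrite -e /set_bit set_set_nth eqxx -zb negbK.
  apply: (@eq_from_nth _ false); first by rewrite (@size_set_bit N) // sz.
  by move=> i _; rewrite nth_set_nth /=; case: eqP => [->|].
by rewrite !flipE.
Qed.

Lemma agree_init_gates (v u w : bits) gs N : N = (size u + size v + size w)%N ->
  (\max_(g <- gs) reach g <= N)%N ->
  agree N (foldl (@apply_gate R) (basis R (u ++ nseq (size v) false ++ w))
             (init_gates (size u) v gs))
          (foldl (@apply_gate R) (basis R (u ++ v ++ w)) gs).
Proof.
elim: v u gs => [|b v IH] u gs //= eN gsN.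
have eN' : N = (size (rcons u false) + size v + size w)%N by rewrite size_rcons; lia.
have gN : (reach (init_gate (size u) b) <= N)%N by case: b => /=; lia.
(* The gate for the first bit of [v] stands last, next to [gs], so the induction hypothesis is used
   with this wire still at 0. *)
have := IH (rcons u false) (init_gate (size u) b :: gs) eN'.
rewrite big_cons geq_max gN => /(_ gsN); rewrite size_rcons !cat_rcons => h x y sx sy.
rewrite h // [foldl _ _ (_ :: _)]/=; apply: agree_gates sx sy => //; rewrite /init_gate.
case: b {h gN eN}; last by rewrite apply_CXid.
by apply: apply_GX_basis; rewrite size_cat eN' size_rcons; lia.
Qed.

Lemma max_init_gates v j gs : \max_(g <- init_gates j v gs) reach g
  = maxn (if v is [::] then 0 else j + size v)%N (\max_(g <- gs) reach g).
Proof.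
elim: v j gs => [|b v IH] j gs /=; first by rewrite max0n.
rewrite IH big_cons (_ : reach _ = j.+1); last by case: b => /=; rewrite ?maxnn.
by case: v {IH} => [|b' v] /=; lia.
Qed.

Lemma sum_first_bit (V : nmodType) N o (F : bits -> V) : (o < N)%N ->
  \sum_(z : (N - 1).-tuple bool) F (true :: z)
    = \sum_(y : o.+1.-tuple bool | nth false y 0) \sum_(z : (N - o.+1).-tuple bool) F (y ++ z).
Proof.
move=> oN; pose G x := if nth false x 0 then F x else 0.
transitivity (\sum_(x : N.-tuple bool) G x).
  case: N oN => // N _; rewrite (sum_tuple_cons N G) big_bool /= subn1 /=.
  by rewrite [X in _ = _ + X]big1 ?addr0.
rewrite (sum_tuple_cat G (esym (subnKC oN))) [RHS]big_mkcond /=; apply: eq_bigr => y _.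
rewrite /G; case: y => -[|[] y] //= _; last by rewrite big1.
Qed.

Definition final n c rho : op R :=
  foldl (@apply_gate R) (tens n rho (basis R (nseq (width n c - n) false))) (gates c).

(** Measuring all outputs and looking at the first amounts to tracing out everything but wire 0.
    Stating it for any [out] that agrees with the final operator allows the circuit with hard-wired
    input to be substituted. *)
Lemma sum_Pr_first_bit n c rho o N out : outs c = o.+1 -> width n c = N ->
  agree N (final n c rho) out ->
  \sum_(y : (outs c).-tuple bool | nth false y 0) Pr n c rho y
    = complex.Re (\sum_(z : (N - 1).-tuple bool) out (true :: z) (true :: z)).
Proof.
move=> oE wE h; have oN : (o < N)%N.
  by rewrite -wE /width !leq_max oE leqnn orbT.
rewrite (@sum_first_bit _ N o (fun x => out x x) oN) -Re_sum /channel.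
rewrite -/(final n c rho) wE oE.
congr complex.Re; apply: eq_bigr => y _; apply: eq_bigr => z _.
by apply: h; rewrite size_cat !size_tuple subnKC.
Qed.

Lemma Pr_attach_nil n c rho : (0 < outs c)%N ->
  Pr n (attach [::] c) rho [:: true]
    = \sum_(y : (outs c).-tuple bool | nth false y 0) Pr n c rho y.
Proof.
case oE: (outs c) => [|o] // _; rewrite -oE.
(* Reducing the outputs to one could shrink the circuit; [CX o o] keeps all wires up to the last
   former output in use. *)
have wE : width n (attach [::] c) = width n c.
  by rewrite /attach oE /width /= oE big_cons /=; lia.
rewrite (sum_Pr_first_bit oE erefl (fun x y _ _ => erefl)).
rewrite /Pr /channel wE /final /attach oE.
by rewrite [gates _]/= [foldl _ _ (_ :: _)]/= -/(apply_gate _ (CX o o)) apply_CXid.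
Qed.

Lemma Pr_attach v c : Pr 0 (attach v c) (basis R [::]) [:: true]
  = \sum_(y : (outs c).-tuple bool | nth false y 0) Pr (size v) c (basis R v) y.
Proof.
have tens0 s : tens 0 (basis R [::]) (basis R s) = basis R s.
  apply: funext => x; apply: funext => y.
  by rewrite /tens !take0 !drop0 {1}/basis eqxx mul1r.
case oE: (outs c) => [|o].
  (* Without outputs both sides vanish: bit 0 of the empty string reads as false, and the empty
     circuit leaves its wire at 0. *)
  rewrite big_pred0; last by move=> y; rewrite tuple0.
  by rewrite /Pr /channel /attach oE /width /= big_nil tens0 /= big1.
rewrite -oE; set N := width (size v) c.
have vN : (size v <= N)%N by rewrite /N /width !leq_max leqnn.
have gN : (\max_(g <- CX o o :: gates c) reach g <= N)%N.
  by rewrite /N /width big_cons /= oE; lia.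
have wE : width 0 (attach v c) = N.
  rewrite /attach oE /width /= max_init_gates /N /width big_cons oE /=.
  by case: (v) => [|b w] /=; lia.
rewrite (@sum_Pr_first_bit _ _ _ o N (final 0 (attach v c) (basis R [::])) oE erefl).
  by rewrite /Pr /channel wE /final wE /attach oE.
rewrite /final wE /attach oE tens0 subn0 => x y sx sy.
(* All wires start at 0; the first [size v] get written, and the others are the ancillas of [c]. *)
have := @agree_init_gates v [::] (nseq (N - size v) false) _ N _ gN.
rewrite size_nseq add0n subnKC // => /(_ erefl x y sx sy).
rewrite !cat0s -nseqD subnKC // => ->; rewrite [RHS]/= -/(apply_gate _ (CX o o)) apply_CXid.
apply: agree_gates sx sy; first by rewrite /N /width; lia.
move=> {}x {}y sx sy; rewrite /tens /basis -natrM mulnb.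
have e z : (z == v ++ nseq (N - size v) false)
    = (take (size v) z == v) && (drop (size v) z == nseq (N - size v) false).
  apply/eqP/andP => [->|[/eqP zv /eqP zd]].
    by rewrite take_size_cat ?drop_size_cat.
  by rewrite -zd -{1}(cat_take_drop (size v) z) zv.
by rewrite !e andbACA.
Qed.

Lemma channel_flip m (x y : bits) : (0 < m)%N -> size x = (m + m)%N -> size y = (m + m)%N ->
  channel 0 (Circuit (m + m) [:: GX m]) (basis R [::]) x y
    = basis R (nseq m false ++ true :: nseq m.-1 false) x y.
Proof.
move=> m0 sx sy; rewrite /channel.
have -> : width 0 (Circuit (m + m) [:: GX m]) = (m + m)%N.
  by rewrite /width /= big_seq1 /=; lia.
rewrite [outs _]/= subnn; set out := foldl _ _ _.
rewrite (sum_tuple0 (fun z => out (x ++ z) (y ++ z))) !cats0 {}/out [foldl _ _ _]/= subn0.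
have -> : tens 0 (basis R [::]) (basis R (nseq (m + m) false))
    = basis R (nseq m false ++ false :: nseq m.-1 false).
  apply: funext => u; apply: funext => v.
  rewrite /tens !take0 !drop0 {1}/basis eqxx mul1r nseqD.
  by case: m m0 {sx sy}.
have := @apply_GX_basis (m + m) (nseq m false) (nseq m.-1 false) false.
by rewrite !size_nseq => h; apply: h; rewrite ?prednK.
Qed.

(** A boolean factor is enough to discard the message pairs that the first stage never outputs; for
    [false] every gate maps the zero operator to itself. *)
Lemma Pr_scale n c rho (b : bool) y :
  Pr n c (fun u v => b%:R * rho u v) y = b%:R * Pr n c rho y.
Proof.
case: b; first by rewrite mul1r; congr Pr; do 2!apply: funext => ?; rewrite mul1r.
rewrite mul0r /Pr /channel big1 // => z _.
have : forall u v, tens n (fun u v => false%:R * rho u v) (basis R (nseq (width n c - n) false)) u v = 0.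
  by move=> u v; rewrite /tens !mul0r.
elim: (gates c) (tens _ _ _) => [|g gs IH] sigma h /=; first exact: h.
apply: IH => u v; case: g => [j|j|j|c' t] /=; rewrite ?h //.
all: by rewrite /conj1 big1 // => a _; rewrite big1 // => b' _; rewrite h mulr0 mul0r.
Qed.

End AttachSemantics.

(** * From estimates to guesses, and the game for fixed messages *)

Section Attack.

Lemma binaryS m i : binary m.+1 i = odd i :: binary m i./2.
Proof.
rewrite /binary /= divn1; congr cons; rewrite -[1%N]addn0 iotaDl -map_comp.
by apply: eq_map => j /=; rewrite add1n expnS divnMA divn2.
Qed.

(** Makes every decryption key an admissible index of the measurement family. *)
Lemma binary_surj (v : bits) : exists2 i, (i < 2 ^ size v)%N & binary (size v) i = v.
Proof.
elim: v => [|b v [i lti e]]; first by exists 0%N.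
exists (b + i.*2)%N; first by rewrite /= expnS mul2n -ltn_half_double /= half_bit_double.
by rewrite /= binaryS half_bit_double e oddD odd_double addbF; case: b.
Qed.

(** The binary form of the last key index is all ones, hence also the unary form of the key length;
    so the program that computes [dklen] supplies this input of the tomography procedure too. *)
Lemma binary_max m : binary m (2 ^ m).-1 = unary m.
Proof.
elim: m => // m IH; rewrite binaryS /= -IH.
have e : (2 ^ m.+1).-1 = (true + (2 ^ m).-1.*2)%N.
  by rewrite expnS; have := expn_gt0 2 m; lia.
by rewrite e half_bit_double oddD odd_double.
Qed.

Variable R : realType.

Lemma value_cons b (y : bits) : value R (b :: y) = (b%:R + value R y) / 2%:R.
Proof.
rewrite /value big_ord_recl /= expr1 mulrDl mulr_suml; congr (_ + _).
by apply: eq_bigr => j _; rewrite /= /bump /= add1n exprS invfM; ring.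
Qed.

Lemma value_bounds (y : bits) : 0 <= value R y <= 1.
Proof.
elim: y => [|b y IH]; first by rewrite /value big_ord0 lexx ler01.
by rewrite value_cons; case/andP: IH => v0 v1; apply/andP; case: b => /=; split; lra.
Qed.

Lemma value_first_bit (y : bits) :
  if nth false y 0 then 2%:R^-1 <= value R y else value R y <= 2%:R^-1.
Proof.
case: y => [|b y] /=; first by rewrite /value big_ord0 invr_ge0 ler0n.
by have /andP[v0 v1] := value_bounds y; rewrite value_cons; case: b => /=; lra.
Qed.

Lemma ler_sum_sub (I : finType) (P Q : pred I) (F : I -> R) :
  (forall i, 0 <= F i) -> (forall i, P i -> Q i) ->
  \sum_(i | P i) F i <= \sum_(i | Q i) F i.
Proof.
move=> F0 PQ; rewrite big_mkcond [leRHS]big_mkcond /=; apply: ler_sum => i _.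
by case: ifP => [/PQ ->|] //; case: ifP.
Qed.

Lemma sum_PrC n c (rho : op R) (P : pred bits) : state n rho ->
  \sum_(y : (outs c).-tuple bool | ~~ P y) Pr n c rho y
    = 1 - \sum_(y : (outs c).-tuple bool | P y) Pr n c rho y.
Proof.
move=> [_ t]; rewrite -(sum_Pr c t) [in RHS](bigID (fun y : (outs c).-tuple bool => P y)) /=.
by rewrite addrC addrK.
Qed.

(** When [p] is farther than [eps] from 1/2, an accurate estimate lies on the same side of 1/2 as
    [p], and its first binary digit reveals the side. *)
Lemma first_bit_estimate (C : circuit) (m : nat) (v : bits) (i : nat) (p eps : R) :
  size v = m -> binary m i = v ->
  (2%:R^-1 + eps < p -> Pr_accurate C m i p eps <= Pr 0 (attach v C) (basis R [::]) [:: true]) /\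
  (p < 2%:R^-1 - eps -> Pr 0 (attach v C) (basis R [::]) [:: true] <= 1 - Pr_accurate C m i p eps).
Proof.
move=> <- e; rewrite Pr_attach /Pr_accurate e.
have F0 (y : (outs C).-tuple bool) : 0 <= Pr (size v) C (basis R v) y.
  by apply: Pr_ge0; exact: gram_basis.
split=> hp.
  apply: ler_sum_sub => // y; rewrite ler_norml => /andP[h _].
  by have := value_first_bit y; case: nth => //; lra.
rewrite -(sum_PrC C (fun y => `|value R y - p| <= eps) (state_basis R (erefl (size v)))).
apply: ler_sum_sub => // y y0; rewrite ler_norml negb_and -!ltNge.
by have := value_first_bit y; rewrite y0; case: ltP => //= _; lra.
Qed.

(** The Markov argument for a single pair of keys: [loss] is linear in the decryption error, so
    averaging over keys needs no distinction between good and bad ones. *)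
Lemma key_advantage (n kk m i : nat) (c q : circuit) (rho : op R) (dk y : bits)
    (eps delta : R) :
  state n rho -> (0 < outs c)%N -> size y = outs c -> size dk = m -> binary m i = dk ->
  0 < eps < 2%:R^-1 -> 0 < delta ->
  1 - delta <= \sum_(w : (outs q).-tuple bool) Pr (kk * n) q (tens_pow n kk rho) w
     * Pr_accurate (decode w) m i (Pr n (attach [::] c) rho [:: true]) eps ->
  forall g loss : R,
  g = \sum_(w : (outs q).-tuple bool) Pr (kk * n) q (tens_pow n kk rho) w
     * Pr 0 (attach dk (decode w)) (basis R [::]) [:: true] ->
  loss = (1 - Pr n c rho y) / (2%:R^-1 - eps) ->
  if nth false y 0 then 1 - delta - loss <= g else g <= delta + loss.
Proof.
move=> st c0 sy sdk hi eps12 d0; rewrite Pr_attach_nil //.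
set p := \sum_(z : (outs c).-tuple bool | nth false z 0) Pr n c rho z => acc g loss gE lossE.
have /andP[eps0 eps2] := eps12.
have [gst tst] := state_tens_pow kk st.
have P0 w : 0 <= Pr (kk * n) q (tens_pow n kk rho) w by exact: Pr_ge0.
have P1 := sum_Pr q tst.
have F0 (z : (outs c).-tuple bool) : 0 <= Pr n c rho z by apply: Pr_ge0; case: st.
have [t yP] : exists t : (outs c).-tuple bool, val t = y.
  by move/eqP: sy => sy; exists (Tuple sy).
have cor : if nth false y 0 then Pr n c rho y <= p else Pr n c rho y <= 1 - p.
  rewrite -yP; case: ifP => h; first by rewrite /p (bigD1 t) //= lerDl sumr_ge0.
  rewrite /p -(sum_PrC c (fun z => nth false z 0) st) (bigD1 t) ?h //=.
  by rewrite lerDl sumr_ge0.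
have B01 w : 0 <= Pr 0 (attach dk (decode w)) (basis R [::]) [:: true] <= 1.
  rewrite Pr_ge0 /=; last exact: gram_basis.
  have [_ tb] := state_basis R (erefl (size dk)).
  rewrite Pr_attach -(sum_Pr (decode w) tb); apply: ler_sum_sub => // z.
  by apply: Pr_ge0; exact: gram_basis.
have g01 : 0 <= g <= 1.
  rewrite gE sumr_ge0 /=; last by move=> w _; rewrite mulr_ge0 //; case/andP: (B01 w).
  by rewrite -P1; apply: ler_sum => w _; rewrite ler_piMr //; case/andP: (B01 w).
have eta0 : 0 < 2%:R^-1 - eps by lra.
(* An error of at least 1/2 - eps makes [loss] at least 1, and 0 <= g <= 1 suffices. A smaller error
   puts [p] more than [eps] beyond 1/2, on the side given by the first bit of [y]. *)
have [bad|good] := leP (2%:R^-1 - eps) (1 - Pr n c rho y).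
  have : 1 <= loss by rewrite lossE ler_pdivlMr // mul1r.
  by case: ifP => _; lra.
have loss0 : 0 <= loss.
  rewrite lossE divr_ge0 //; last exact: ltW.
  have [_ tr] := st; rewrite -(sum_Pr c tr) -yP (bigD1 t) //=.
  by rewrite addrAC subrr add0r sumr_ge0.
have est w := first_bit_estimate (decode w) p eps sdk hi.
move: cor; case: ifP => _ cor.
  apply: le_trans (_ : 1 - delta <= _); first by lra.
  rewrite gE; apply: le_trans acc _; apply: ler_sum => w _; apply: ler_wpM2l => //.
  by apply: (est w).1; lra.
apply: le_trans (_ : delta <= _); last by lra.
suff : g <= 1 - \sum_(w : (outs q).-tuple bool) Pr (kk * n) q (tens_pow n kk rho) w
     * Pr_accurate (decode w) m i p eps by lra.
rewrite gE -P1 -sumrB; apply: ler_sum => w _; rewrite -[X in _ <= X - _]mulr1 -mulrBr.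
by apply: ler_wpM2l => //; apply: (est w).2; lra.
Qed.

Variable S : ute.

Definition challenge (lam : nat) (b : bool) : bits :=
  if b then true :: nseq (mlen S lam).-1 false else nseq (mlen S lam) false.

Lemma size_challenge lam b : size (challenge lam b) = mlen S lam.
Proof.
by rewrite /challenge; case: b => /=; rewrite size_nseq // prednK // mlen_gt0.
Qed.

Lemma Pr_game_flip (t : nat -> nat) (A : adversary S) (b : bool) (lam : nat) :
  rlen A lam = 0%N -> A1 A lam = Circuit (mlen S lam + mlen S lam) [:: GX (mlen S lam)] ->
  Pr_game R t A b lam =
  \sum_(ek : (eklen S lam).-tuple bool) \sum_(dk : (dklen S lam).-tuple bool)
    Pr_key R S lam ek dk *
    \sum_(st : (outs (A2 A lam)).-tuple bool)
      Pr (t lam * clen S lam) (A2 A lam)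
        (tens_pow (clen S lam) (t lam) (ciphertext R S lam ek (challenge lam b))) st
      * Pr 0 (B A lam st dk) (basis R [::]) [:: true].
Proof.
move=> r0 hA1.
pose F m0 m1 := \sum_(ek : (eklen S lam).-tuple bool) \sum_(dk : (dklen S lam).-tuple bool)
    Pr_key R S lam ek dk *
    \sum_(st : (outs (A2 A lam)).-tuple bool)
      Pr (rlen A lam + t lam * clen S lam) (A2 A lam)
        (tens (rlen A lam) (kept_state R A lam m0 m1)
           (tens_pow (clen S lam) (t lam)
              (ciphertext R S lam ek (if b then m1 else m0)))) st
      * Pr 0 (B A lam st dk) (basis R [::]) [:: true].
(* With an empty register the kept state is a scalar: the indicator that the measured messages are
   the two challenges. *)
have kept (m0 m1 : (mlen S lam).-tuple bool) sigma :
    tens (rlen A lam) (kept_state R A lam m0 m1) sigma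
    = fun u v => ((val m0 == challenge lam false) && (val m1 == challenge lam true))%:R * sigma u v.
  apply: funext => u; apply: funext => v.
  rewrite /tens r0 !take0 !drop0 /kept_state hA1 !cats0 channel_flip ?size_cat ?size_tuple ?mlen_gt0 //.
  by rewrite /basis andbb eqseq_cat ?size_tuple ?size_nseq.
have F0 (m0 m1 : (mlen S lam).-tuple bool) :
    (val m0 == challenge lam false) && (val m1 == challenge lam true) = false -> F m0 m1 = 0.
  move=> h; apply: big1 => ek _; apply: big1 => dk _.
  by rewrite big1 ?mulr0 // => st _; rewrite kept h Pr_scale mul0r mul0r.
transitivity (F (challenge lam false) (challenge lam true)).
  have -> : Pr_game R t A b lam = \sum_(m0 : (mlen S lam).-tuple bool)
      \sum_(m1 : (mlen S lam).-tuple bool) F m0 m1 by rewrite /F; case: (b).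
  rewrite -(@sum_tuple1 _ (mlen S lam) _ (fun m0 => F m0 (challenge lam true))) ?size_challenge //.
    apply: eq_bigr => m0 _; apply: (@sum_tuple1 _ (mlen S lam) _ (F m0)); first exact: size_challenge.
    by move=> m1 /negPf h; apply: F0; rewrite h andbF.
  move=> m0 /negPf h.
  have s1 : size (challenge lam true) == mlen S lam by rewrite size_challenge.
  by rewrite -[challenge lam true]/(val (Tuple s1)) F0 // h.
have s b' : size (challenge lam b') == mlen S lam by rewrite size_challenge.
apply: eq_bigr => ek _; apply: eq_bigr => dk _; congr (_ * _); apply: eq_bigr => st _.
rewrite -[challenge lam false]/(val (Tuple (s false))) -[challenge lam true]/(val (Tuple (s true))).
rewrite kept /= !eqxx Pr_scale mul1r r0 add0n.
by case: (b).
Qed.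

Lemma sum_Pr_key lam :
  \sum_(ek : (eklen S lam).-tuple bool) \sum_(dk : (dklen S lam).-tuple bool)
    Pr_key R S lam ek dk = 1.
Proof.
have [_ t] := state_basis R (erefl (size [::])).
rewrite -(sum_tuple_cat (fun x => Pr 0 (Gen S lam) (basis R [::]) x) (Gen_outs S lam)).
exact: sum_Pr.
Qed.

End Attack.

(** Taking a power of two for [M] makes log M the key length and the binary indices exactly the
    keys, so the number of copies is the one in the theorem. The definition is transparent because
    later steps compute its fields. *)
Definition message_test (S : ute) (q : prog)
    (hq : generates q 1 (fun lam xs => attach [::] (Dec S lam (nth [::] xs 0)))) : meas_family.
Proof.
refine (@MeasFamily (clen S) (fun lam => 2 ^ dklen S lam)%N _ q
  (fun lam xs => attach [::] (Dec S lam (nth [::] xs 0))) (clen_ptime S) _ hq _).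
- by move=> lam; rewrite expn_gt0.
- have [p [P hP]] := dklen_ptime S; exists p, P => lam.
  by rewrite /log2up up_expnK // binary_max.
- by [].
Defined.

(** * The advantage averaged over the keys *)

Section Advantage.
Variables (R : realType) (S : ute).

(** Each of the two messages costs [delta] for tomography and nu / (1/2 - eps) for decryption
    errors; together they account for the factors 2. *)
Lemma game_advantage (t : nat -> nat) (A : adversary S) (lam : nat) (eps delta nu : R) :
  rlen A lam = 0%N -> A1 A lam = Circuit (mlen S lam + mlen S lam) [:: GX (mlen S lam)] ->
  (forall st dk, B A lam st dk = attach dk (decode st)) ->
  0 < eps < 2%:R^-1 -> 0 < delta ->
  (forall m : (mlen S lam).-tuple bool, 1 - nu <= Pr_correct R S lam m) ->
  (forall (rho : op R) (dk : bits), state (clen S lam) rho -> size dk = dklen S lam ->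
     exists2 i, binary (dklen S lam) i = dk &
     1 - delta <= \sum_(w : (outs (A2 A lam)).-tuple bool)
       Pr (t lam * clen S lam) (A2 A lam) (tens_pow (clen S lam) (t lam) rho) w
       * Pr_accurate (decode w) (dklen S lam) i
           (Pr (clen S lam) (attach [::] (Dec S lam dk)) rho [:: true]) eps) ->
  1 - 2%:R * delta - 2%:R * nu / (2%:R^-1 - eps)
    <= Pr_game R t A true lam - Pr_game R t A false lam.
Proof.
move=> r0 hA1 hB eps12 d0 cor tomo.
have eta0 : 0 < 2%:R^-1 - eps by case/andP: eps12; lra.
pose cp (ek : (eklen S lam).-tuple bool) (dk : (dklen S lam).-tuple bool) b :=
  Pr (clen S lam) (Dec S lam dk) (ciphertext R S lam ek (challenge S lam b)) (challenge S lam b).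
pose g (ek : (eklen S lam).-tuple bool) (dk : (dklen S lam).-tuple bool) b :=
  \sum_(st : (outs (A2 A lam)).-tuple bool)
      Pr (t lam * clen S lam) (A2 A lam)
        (tens_pow (clen S lam) (t lam) (ciphertext R S lam ek (challenge S lam b))) st
      * Pr 0 (B A lam st dk) (basis R [::]) [:: true].
have K0 ek dk : 0 <= Pr_key R S lam ek dk by apply: Pr_ge0; exact: gram_basis.
have ct ek b : size ek = eklen S lam ->
    state (clen S lam) (ciphertext R S lam ek (challenge S lam b)).
  move=> sek; rewrite -(Enc_outs sek (size_challenge S lam b)).
  exact/state_channel/state_basis.
have key (ek : (eklen S lam).-tuple bool) (dk : (dklen S lam).-tuple bool) b :
    if b then 1 - delta - (1 - cp ek dk b) / (2%:R^-1 - eps) <= g ek dk b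
    else g ek dk b <= delta + (1 - cp ek dk b) / (2%:R^-1 - eps).
  have sdk := size_tuple dk; have st := ct _ b (size_tuple ek).
  have [i hi acc] := tomo _ _ st sdk.
  have c0 : (0 < outs (Dec S lam dk))%N by rewrite (Dec_outs sdk) mlen_gt0.
  have sy : size (challenge S lam b) = outs (Dec S lam dk).
    by rewrite size_challenge (Dec_outs sdk).
  have := key_advantage st c0 sy sdk hi eps12 d0 acc _ erefl.
  rewrite (_ : nth false _ 0 = b); last first.
    by rewrite /challenge; case: (b) => //; rewrite nth_nseq if_same.
  by apply; apply: eq_bigr => w _; rewrite hB.
have sumcp b : 1 - nu <= \sum_(ek : (eklen S lam).-tuple bool)
    \sum_(dk : (dklen S lam).-tuple bool) Pr_key R S lam ek dk * cp ek dk b.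
  have sc : size (challenge S lam b) == mlen S lam by rewrite size_challenge.
  exact: (cor (Tuple sc)).
have sumK := sum_Pr_key R S lam.
(* The keys have total weight 1, so the mean of 1 - cp is the correctness error of one fixed
   message, at most [nu]. *)
have loss b : \sum_(ek : (eklen S lam).-tuple bool) \sum_(dk : (dklen S lam).-tuple bool)
    Pr_key R S lam ek dk * ((1 - cp ek dk b) / (2%:R^-1 - eps)) <= nu / (2%:R^-1 - eps).
  rewrite ler_pdivlMr // mulr_suml.
  suff -> : \sum_(ek : (eklen S lam).-tuple bool)
      (\sum_(dk : (dklen S lam).-tuple bool)
        Pr_key R S lam ek dk * ((1 - cp ek dk b) / (2%:R^-1 - eps))) * (2%:R^-1 - eps)
      = 1 - \sum_(ek : (eklen S lam).-tuple bool) \sum_(dk : (dklen S lam).-tuple bool)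
          Pr_key R S lam ek dk * cp ek dk b by have := sumcp b; lra.
  rewrite -[X in _ = X - _]sumK -sumrB; apply: eq_bigr => ek _; rewrite mulr_suml -sumrB.
  by apply: eq_bigr => dk _; rewrite -mulrA divfK ?gt_eqF // mulrBr mulr1.
have hi : 1 - delta - nu / (2%:R^-1 - eps) <= Pr_game R t A true lam.
  rewrite (@Pr_game_flip R S) //.
  apply: le_trans (_ : 1 - delta - \sum_(ek : (eklen S lam).-tuple bool)
    \sum_(dk : (dklen S lam).-tuple bool)
    Pr_key R S lam ek dk * ((1 - cp ek dk true) / (2%:R^-1 - eps)) <= _).
    by have := loss true; lra.
  (* The constant 1 - delta is spread over the keys by their weights, which reduces the bound to one
     key pair at a time. *)
  rewrite -[X in X - _ <= _]mul1r -{1}sumK mulr_suml -sumrB; apply: ler_sum => ek _.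
  rewrite mulr_suml -sumrB; apply: ler_sum => dk _; rewrite -mulrBr.
  by apply: ler_wpM2l => //; exact: (key ek dk true).
have lo : Pr_game R t A false lam <= delta + nu / (2%:R^-1 - eps).
  rewrite (@Pr_game_flip R S) //.
  apply: le_trans (_ : _ <= delta + \sum_(ek : (eklen S lam).-tuple bool)
    \sum_(dk : (dklen S lam).-tuple bool)
    Pr_key R S lam ek dk * ((1 - cp ek dk false) / (2%:R^-1 - eps))) _; last first.
    by have := loss false; lra.
  rewrite -[X in _ <= X + _]mul1r -{1}sumK mulr_suml -big_split /=; apply: ler_sum => ek _.
  rewrite mulr_suml -big_split /=; apply: ler_sum => dk _; rewrite -mulrDr.
  by apply: ler_wpM2l => //; exact: (key ek dk false).
rewrite -mulrA; lra.
Qed.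

Lemma negligible_small (f : nat -> R) (e : R) : negligible f -> 0 < e ->
  exists lam0 : nat, forall lam, (lam0 <= lam)%N -> `|f lam| <= e.
Proof.
(* Decay as 1/lam is enough; the successor makes [lam] positive, as [negligible] demands. *)
move=> /(_ 1%N) [l0 h] e0; exists (maxn l0 (Num.bound e^-1).+1) => lam.
rewrite geq_max => /andP[l0l bl]; apply: le_trans (h _ l0l _) _; first by lia.
rewrite expr1 -[e]invrK lef_pV2 ?posrE ?invr_gt0 ?ltr0n //; last by lia.
apply: ltW; apply: lt_le_trans (archi_boundP _) _; first by rewrite invr_ge0 ltW.
by rewrite ler_nat ltnW.
Qed.

End Advantage.

(* The attack runs the tomography procedure on n = clen lam qubits and on the
   M = 2 ^ dklen lam decryption keys. *)
Theorem theorem3p25 (R : realType) (k : {mpoly R[4]}) :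
  (exists T : prog, hyper_efficient_shadow_tomography k T) ->
  forall eps delta : R, 0 < eps < 2%:R^-1 -> 0 < delta < 2%:R^-1 ->
  ~ exists S : ute,
      correct R S
      /\ copy_secure R S (fun lam => copies k (clen S lam) (dklen S lam) eps delta).
Proof.
move=> [T hT] eps delta eps12 delta12 [S [[nu nu0 cor] sec]].
have [q hq] : exists q, generates q 1 (fun lam xs => attach [::] (Dec S lam (nth [::] xs 0))).
  by have [p hp] := Dec_qpt S; exact: generates_attach hp.
(* The polynomial depends on the family only, so it serves for all [lam] at once. *)
have [P {}hT] := hT (message_test hq).
have eps01 : 0 < eps < 1 by lra.
have delta01 : 0 < delta < 1 by lra.
have mE lam : log2up (M (message_test hq) lam) = dklen S lam by rewrite /log2up up_expnK.
have {}hT lam := hT lam eps delta eps01 delta01.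
(* An adversary needs its circuits as a function of [lam], while [T] is specified by a relation.
   Choice only names the outputs; they are still printed by [T]. *)
have /choice[Q hQ] : forall lam, exists w : bits,
    computes_within T (tomography_input (message_test hq) lam eps delta)
      P.[(lam + clen S lam + dklen S lam + inv_up eps + log_inv_up delta)%N] w /\
    forall (rho : op R) (i : nat), density (clen S lam) rho -> (i < 2 ^ dklen S lam)%N ->
      1 - delta <= \sum_(w' : (outs (decode w)).-tuple bool)
        Pr (copies k (clen S lam) (dklen S lam) eps delta * clen S lam) (decode w)
          (tens_pow (clen S lam) (copies k (clen S lam) (dklen S lam) eps delta) rho) w'
        * Pr_accurate (decode w') (dklen S lam) i
            (Pr (clen S lam) (attach [::] (Dec S lam (binary (dklen S lam) i))) rho [:: true]) eps.
  move=> lam; have [w hw acc] := hT lam; exists w.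
  rewrite mE in hw acc; split=> // rho i hr hi; have := acc rho i hr hi.
  by rewrite /Pr_E mE.
have A2q : qpt 0 (fun lam _ => decode (Q lam)).
  apply: (@generates_preprocess T (clen S) (dklen S) (code_prog q) (unary (inv_up eps))
    (unary (log_inv_up delta)) P (inv_up eps) (log_inv_up delta) Q (clen_ptime S) (dklen_ptime S)).
  move=> lam; have [h _] := hQ lam; move: h.
  by rewrite /tomography_input mE binary_max.
pose A := @Adversary S (fun _ => 0%N) (fun lam => Circuit (mlen S lam + mlen S lam) [:: GX (mlen S lam)])
  (fun lam => decode (Q lam)) (fun _ st dk => attach dk (decode st))
  (generates_flip (mlen_ptime S)) A2q generates_attach_decode
  (fun lam => esym (addn0 _)) (fun _ _ _ => erefl).
pose c := 1 - 2%:R * delta; pose eta := 2%:R^-1 - eps.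
have c0 : 0 < c by rewrite /c; lra.
have eta0 : 0 < eta by rewrite /eta; lra.
(* If nu is at most c eta / 8, the loss 2 nu / eta is at most c / 4, so the advantage is at least 3c
   / 4, against the c / 4 allowed by security. *)
have [l1 small1] := negligible_small (sec A) (e := c / 4%:R) ltac:(lra).
have [l2 small2] := negligible_small nu0 (e := c * eta / 8%:R) ltac:(nra).
pose lam := maxn l1 l2.
have := small1 lam (leq_maxl _ _); have := small2 lam (leq_maxr _ _).
rewrite normr_id => hnu hgame.
have : 1 - 2%:R * delta - 2%:R * nu lam / eta
    <= Pr_game R (fun lam => copies k (clen S lam) (dklen S lam) eps delta) A true lam
     - Pr_game R (fun lam => copies k (clen S lam) (dklen S lam) eps delta) A false lam.
  apply: game_advantage => //; first by case/andP: delta12.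
  move=> rho dk st sdk; have [_ acc] := hQ lam.
  have [i hi ei] := binary_surj dk; rewrite sdk in hi ei.
  by exists i => //; have := acc rho i (state_density st) hi; rewrite ei.
have : 2%:R * nu lam / eta <= c / 4%:R.
  rewrite ler_pdivrMr //; have := ler_norm (nu lam); lra.
have := ler_norm (- (Pr_game R (fun lam => copies k (clen S lam) (dklen S lam) eps delta) A false lam
     - Pr_game R (fun lam => copies k (clen S lam) (dklen S lam) eps delta) A true lam)).
rewrite normrN; rewrite /c in c0 hnu hgame *; lra.
Qed.
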